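(* Let $D$ be a prime. Consider an $n$-qudit Floquet code on a three-colorable $\{p,3\}$-lattice on a closed orientable surface of genus $\mathfrak{g}$, with $p\ge6$ and $\mathfrak{g}\ge2$, whose checks $C_g,C_r,C_b$ satisfy the commutation conditions (i)–(iii) given in the context. Let $k$ be the number of logical qudits it encodes. Then its encoding rate is $$\frac{k}{n}=\frac12-\frac3p+\frac2n .$$ Hence $\frac{k}{n}\to\frac12$ as $n\to\infty$ and $p\to\infty$.
   Context: Paulis: $\omega=e^{2\pi i/D}$, $[D]=\{0,\dots,D-1\}$, arithmetic mod $D$; $X=\sum_j|j+1\bmod D\rangle\langle j|$, $Z=\sum_j\omega^j|j\rangle\langle j|$ on $\mathbb{C}^D$; $P_{a,b}=X^aZ^b$; $\mathcal{P}_D=\{\omega^lP_{a,b}:a,b,l\in[D]\}$. The commutation function is $c(P_{a,b},P_{a',b'})=-ab'+ba'\in\mathbb{Z}/D$. For $P\in\mathcal{P}_D$ and a vertex $v$, $[P]_v$ denotes the $n$-qudit operator acting as $P$ on qudit $v$ and as the identity on all other qudits. Lattice: one qudit of dimension $D$ sits on each vertex, $n=|V|$. A $\{p,3\}$-lattice on a closed orientable surface is a tessellation (cellular embedding of a connected simple graph $(V,E)$) in which every face (''plaquette'') has $p$ edges and every vertex has degree $3$. Three-colorable means that the faces can be colored green ($g$), red ($r$), blue ($b$) so that faces sharing an edge have different colors; fix such a coloring. An edge gets color $l$ if the two faces it connects (those at its two endpoints and not containing the edge in their boundary) have color $l$; thus each vertex meets exactly one edge of each color. $E_l$ is the set of color-$l$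 edges. Checks: for every $v\in V$, $l\in\{g,r,b\}$ a phaseless Pauli $P_{v_l}=X^aZ^b$ with $(a,b)=v_l\in[D]\times[D]$ is given, and $C_l=\{[P_{v_l}]_v[P_{u_l}]_u:(v,u)\in E_l\}$. The conditions are: (i) $c(P_{v_g},P_{v_b})=-c(P_{u_g},P_{u_b})$ for all $(v,u)\in E_g$; $c(P_{v_r},P_{v_g})=-c(P_{u_r},P_{u_g})$ for all $(v,u)\in E_r$; $c(P_{v_b},P_{v_r})=-c(P_{u_b},P_{u_r})$ for all $(v,u)\in E_b$. (ii) For every $v\in V$, $c(P_{v_g},P_{v_r})$, $c(P_{v_r},P_{v_b})$ and $c(P_{v_b},P_{v_g})$ are all nonzero. (iii) $[P_{v_g}P_{v_r}P_{v_b}]_v[P_{u_g}P_{u_r}P_{u_b}]_u=I^{\otimes n}$ for every $(v,u)\in E$. Stabilizer groups and update: a stabilizer group $\mathcal{S}$ is an abelian subgroup of $\mathcal{P}_D^{\otimes n}$ without nontrivial scalars; $\mathcal{C}(\mathcal{S})$ is its common $+1$ eigenspace. Measuring an $n$-qudit Pauli $P$ (with $P^D=I$, automatic for odd $D$; for $D=2$ all checks are assumed to satisfy this) with outcome $o\in[D]$ means projecting onto the $\omega^o$-eigenspace of $P$; it updates $\mathcal{S}$ to the group generated by $\omega^{-o}P$ and all elements of $\mathcal{S}$ commuting with $P$ ($o$ being an outcome of nonzero probability on $\mathcal{C}(\mathcal{S})$). Floquet code: start with $\mathcal{S}_{-1}=\{I^{\otimes n}\}$. In round $t\ge0$ measure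 all checks in $C_g$, $C_r$, $C_b$ according to $t\equiv0,1,2\pmod3$ respectively; $\mathcal{S}_t$ is obtained from $\mathcal{S}_{t-1}$ by applying the update for each measurement, for any outcomes of nonzero probability. The code encodes $k$ logical qudits if there is a finite $T$ with $\dim\mathcal{C}(\mathcal{S}_t)=D^k$ for all $t\ge T$ (regardless of the outcomes). *)

(* Defs.v *)
From HB Require Import structures.
From mathcomp Require Import all_boot all_order all_algebra complex.
From mathcomp Require Import all_classical all_reals all_analysis.
Set Implicit Arguments.
Unset Strict Implicit.
Unset Printing Implicit Defensive.
Import Order.TTheory GRing.Theory Num.Theory numFieldNormedType.Exports.
Local Open Scope complex_scope.
Local Open Scope ring_scope.

(* Cellular embeddings of connected simple graphs in closed orientable surfaces
   are encoded as rotation systems: [rot v] is the cyclic order, given by the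
   orientation of the surface, of the neighbours of [v]. *)
Record embedded_graph := EmbeddedGraph {
  vertex : finType;
  adj : rel vertex;
  adj_sym : symmetric adj;
  adj_irrefl : irreflexive adj;
  adj_connected : forall u v, connect adj u v;
  rot : vertex -> vertex -> vertex;
  (* the neighbours of v form a single orbit of rot v *)
  rot_cyclic : forall v u w, adj v u -> fconnect (rot v) u w = adj v w
}.

Arguments adj {e} _ _.
Arguments rot {e} _ _.

(* A dart (oriented edge) is a pair (v, u) with adj v u. *)
Definition face_step (L : embedded_graph) (d : vertex L * vertex L) :
    vertex L * vertex L :=
  (d.2, rot d.2 d.1).

(* The face traced from the dart (v, u), as the set of darts of its boundary
   walk; the two sides of the edge {v, u} are face (v, u) and face (u, v). *)
Definition face (L : embedded_graph) (d : vertex L * vertex L) :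
    {set vertex L * vertex L} :=
  [set d' | fconnect (@face_step L) d d']%SET.

Definition faces (L : embedded_graph) : {set {set vertex L * vertex L}} :=
  [set face d | d : vertex L * vertex L & adj d.1 d.2]%SET.

Definition edges (L : embedded_graph) : {set {set vertex L}} :=
  [set [set d.1; d.2] | d : vertex L * vertex L & adj d.1 d.2]%SET.

Inductive color := Green | Red | Blue.

Definition color_eq_dec : comparable color.
Proof. by move=> x y; rewrite /decidable; decide equality. Defined.

HB.instance Definition _ := hasDecEq.Build color (compareP color_eq_dec).

(* A {p,3}-lattice on the closed orientable surface of genus g, with a fixed
   proper three-coloring of its faces. *)
Record colored_lattice (p g : nat) := ColoredLattice {
  lattice_graph :> embedded_graph;
  lattice_degree :
    forall v : vertex lattice_graph, #|[set u | adj v u]%SET| = 3%N;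
  lattice_face_size : forall f, f \in faces lattice_graph -> #|f| = p;
  lattice_genus :
    #|vertex lattice_graph|%:Z - #|edges lattice_graph|%:Z
      + #|faces lattice_graph|%:Z = 2 - 2 * g%:Z;
  face_color : {set vertex lattice_graph * vertex lattice_graph} -> color;
  face_color_proper : forall v u : vertex lattice_graph, adj v u ->
    face_color (face (v, u)) != face_color (face (u, v))
}.

Definition in_boundary (L : embedded_graph) (v u : vertex L)
    (f : {set vertex L * vertex L}) : bool :=
  ((v, u) \in f) || ((u, v) \in f).

(* (v, u) is an edge of color l: every face at v or at u that does not contain
   this edge in its boundary has color l. The faces at a vertex x are the
   face (x, y) with y a neighbour of x. *)
Definition edge_color (p g : nat) (L : colored_lattice p g) (l : color)
    (v u : vertex L) : Prop :=
  adj v u /\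
  forall x y : vertex L, (x == v) || (x == u) -> adj x y ->
    ~~ in_boundary v u (face (x, y)) -> face_color (face (x, y)) = l.

Definition omega (R : realType) (D : nat) : R[i] :=
  cos (2 * pi / D%:R) +i* sin (2 * pi / D%:R).

Definition shiftX (R : realType) (D : nat) : 'M[R[i]]_D :=
  \matrix_(i, j) ((i == j.+1 %% D :> nat)%N)%:R.

Definition clockZ (R : realType) (D : nat) : 'M[R[i]]_D :=
  \matrix_(i, j) ((omega R D) ^+ j *+ (i == j)).

Definition pauli (R : realType) (D : nat) (ab : 'I_D * 'I_D) : 'M[R[i]]_D :=
  shiftX R D ^+ ab.1 * clockZ R D ^+ ab.2.

(* Values in Z/D; 'F_D is Z/D for D prime, the only case considered. *)
Definition comm (D : nat) (ab ab' : 'I_D * 'I_D) : 'F_D :=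
  - (ab.1%:R * ab'.2%:R) + ab.2%:R * ab'.1%:R.

(* The n-qudit space is spanned by the basis configurations V -> {0,...,D-1},
   numbered by enum_val. *)
Definition hdim (V : finType) (D : nat) : nat := #|{ffun V -> 'I_D}|.

Definition tensor (R : realType) (V : finType) (D : nat)
    (A : V -> 'M[R[i]]_D) : 'M[R[i]]_(hdim V D) :=
  \matrix_(i, j) \prod_(w : V)
    A w ((enum_val i : {ffun V -> 'I_D}) w) ((enum_val j : {ffun V -> 'I_D}) w).

Definition on_site (R : realType) (V : finType) (D : nat) (A : 'M[R[i]]_D)
    (v : V) : 'M[R[i]]_(hdim V D) :=
  tensor (fun w => if w == v then A else 1).

Section Stabilizer.
Context {R : realType} {V : finType} {D : nat}.
Local Notation op := 'M[R[i]]_(hdim V D).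
Local Notation state := 'cV[R[i]]_(hdim V D).
Implicit Types (S : set op) (P : op) (psi : state) (o : 'I_D).

Definition is_group S : Prop :=
  [/\ S 1, (forall A B, S A -> S B -> S (A * B)) &
      (forall A, S A -> S (invmx A))].

Definition generated (G : set op) : set op := smallest is_group G.

Definition codespace S : set state :=
  [set psi | forall A, S A -> A *m psi = psi]%classic.

Definition has_dim (W : set state) (d : nat) : Prop :=
  exists U : {vspace state}, (forall psi, psi \in U <-> W psi) /\ \dim U = d.

Definition eigenprojector P o (Pi : op) : Prop :=
  [/\ Pi * Pi = Pi, map_mx Num.conj Pi^T = Pi &
      forall psi, Pi *m psi = psi <-> P *m psi = omega R D ^+ o *: psi].

(* o has nonzero probability for some state of the code space *)
Definition possible_outcome S P o : Prop :=
  exists (Pi : op) (psi : state),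
    [/\ eigenprojector P o Pi, codespace S psi & Pi *m psi != 0].

Definition update P o S : set op :=
  generated [set A | A = omega R D ^- o *: P \/ (S A /\ A * P = P * A)]%classic.

Fixpoint measured (s : seq op) S S' : Prop :=
  if s is P :: s' then
    exists o : 'I_D, possible_outcome S P o /\ measured s' (update P o S) S'
  else S' = S.

(* each operator of C is measured exactly once, in an arbitrary order *)
Definition measured_all (C : set op) S S' : Prop :=
  exists s : seq op,
    [/\ uniq s, (forall P, P \in s <-> C P) & measured s S S'].

End Stabilizer.

Definition check_set (R : realType) (D p g : nat) (L : colored_lattice p g)
    (e : vertex L -> color -> 'I_D * 'I_D) (l : color) :
    set 'M[R[i]]_(hdim (vertex L) D) :=
  [set P | exists v u : vertex L, edge_color l v u /\
     P = on_site (pauli R (e v l)) v * on_site (pauli R (e u l)) u]%classic.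

Arguments check_set R {D p g L} e l.

Record floquet_code (R : realType) (D p g : nat) := FloquetCode {
  lattice :> colored_lattice p g;
  (* the exponents (a, b) of the color-l Pauli X^a Z^b at each vertex *)
  exps : vertex lattice -> color -> 'I_D * 'I_D;
  comm_green : forall v u, @edge_color p g lattice Green v u ->
    comm (exps v Green) (exps v Blue) = - comm (exps u Green) (exps u Blue);
  comm_red : forall v u, @edge_color p g lattice Red v u ->
    comm (exps v Red) (exps v Green) = - comm (exps u Red) (exps u Green);
  comm_blue : forall v u, @edge_color p g lattice Blue v u ->
    comm (exps v Blue) (exps v Red) = - comm (exps u Blue) (exps u Red);
  comm_neq0 : forall v,
    [/\ comm (exps v Green) (exps v Red) != 0,
        comm (exps v Red) (exps v Blue) != 0 &
        comm (exps v Blue) (exps v Green) != 0];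
  prod_site : forall v u : vertex lattice, adj v u ->
    let Q w := pauli R (exps w Green) * pauli R (exps w Red)
                 * pauli R (exps w Blue) in
    on_site (Q v) v * on_site (Q u) u = 1;
  (* automatic for odd D *)
  check_order : D = 2%N ->
    forall l P, check_set R exps l P -> P ^+ D = 1
}.

Definition qudits (R : realType) (D p g : nat) (F : floquet_code R D p g) : nat :=
  #|vertex F|.

Definition checks (R : realType) (D p g : nat) (F : floquet_code R D p g)
    (l : color) : set 'M[R[i]]_(hdim (vertex F) D) :=
  check_set R (@exps R D p g F) l.

Arguments checks {R D p g} F l.

Definition schedule (t : nat) : color :=
  match (t %% 3)%N with 0%N => Green | 1%N => Red | _ => Blue end.

(* S t is the stabilizer group before round t, i.e. after t rounds; thus the
   group obtained in round t is S t.+1. *)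
Definition is_run (R : realType) (D p g : nat) (F : floquet_code R D p g)
    (S : nat -> set 'M[R[i]]_(hdim (vertex F) D)) : Prop :=
  S 0%N = [set A | A = 1]%classic /\
  forall t, measured_all (checks F (schedule t)) (S t) (S t.+1).

Arguments is_run {R D p g} F S.

Definition encodes (R : realType) (D p g : nat) (F : floquet_code R D p g)
    (k : nat) : Prop :=
  exists T : nat, forall S, is_run F S ->
    forall t, (T <= t)%N -> has_dim (codespace (S t.+1)) (D ^ k)%N.

(* Main.v *)
Require Import Defs.
From HB Require Import structures.
From mathcomp Require Import all_boot all_order all_algebra complex.
From mathcomp Require Import all_classical all_reals all_analysis.
From mathcomp Require Import ring lra zify.
Import Order.TTheory GRing.Theory Num.Theory numFieldNormedType.Exports.
Set Implicit Arguments.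
Unset Strict Implicit.
Unset Printing Implicit Defensive.
Local Open Scope complex_scope.
Local Open Scope classical_set_scope.
Local Open Scope ring_scope.

(** Up to phases, a stabilizer group is an isotropic subspace L of the symplectic
    space (F_D)^{2n}; measuring P replaces L by <P> + (L meet P^perp), and the code
    space has dimension D^n / |L|, the trace of the projector averaging the group.
    Condition (iii) makes the three Paulis at a vertex sum to zero, so they pairwise
    commute up to one constant c_v, and (i) says that c_v changes sign along each
    edge.  Hence a combination of color-l checks commutes with the color-l' checks
    iff its coefficients are constant around the plaquettes of the third color l'',
    and modulo the color-l' checks it is then a combination of plaquette operators
    of color l''; plaquette operators commute with all checks.  After four rounds L
    is spanned by the n/2 checks of the current color and by all plaquettes.
    Connectedness leaves a two-dimensional space of relations between these
    generators, so k = n - (n/2 + #faces - 2), where p #faces = 3n. *)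

(** Measurement outcomes enter only through phases. The invariant [stab S L] quantifies them away:
    it records which labels occur, together with a nonzero vector of the code space, which forces
    each label to carry a single phase. One label set therefore serves all runs, all outcomes and
    all orders within a round. The nonzero vector survives a measurement because a possible outcome
    supplies a nonzero projected state. Products of Paulis of one color are encoded by functions on
    the vertices: checks correspond to functions equal at both ends of each edge, plaquettes to
    functions constant around each face. Their counting thus reduces to counting edges and faces,
    and cardinalities of subgroups replace dimensions. The two relations in the last round, of color
    c, are condition (iii) multiplied over all vertices, which involves the plaquettes of all three
    colors, and the equality of the product of all color-c plaquettes with the product of all
    color-c checks. Since [encodes] quantifies over all runs, uniqueness of k also requires that a
    run exists. *)

Section Omega.
Variables (R : realType) (D : nat).
Hypothesis D_prime : prime D.
Local Notation F := 'F_D.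
Local Notation w := (omega R D).

Lemma omegaX k : w ^+ k = cos (2 * pi / D%:R *+ k) +i* sin (2 * pi / D%:R *+ k).
Proof.
elim: k => [|k IH]; first by rewrite expr0 mulr0n cos0 sin0.
by rewrite exprSr IH (mulrSr _ k) cosD sinD /omega; simpc; congr (_ +i* _); rewrite addrC.
Qed.

Lemma omega_order : w ^+ D = 1.
Proof.
have D0 : D%:R != 0 :> R by rewrite pnatr_eq0 -lt0n prime_gt0.
rewrite omegaX -mulr_natr divfK // mulrC mulr_natr.
by rewrite -[pi *+ 2]add0r cosD2pi sinD2pi cos0 sin0.
Qed.

(** For D > 2 the angle lies strictly between 0 and pi and its sine is positive; for D = 2 the sine
    vanishes, and the cosine -1 is used instead. *)
Lemma omega_neq1 : w != 1.
Proof.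
have D1 := prime_gt1 D_prime.
have D0 : 0 < D%:R :> R by rewrite ltr0n prime_gt0.
have pi0 := pi_gt0 R.
rewrite eq_complex /= negb_and.
have [D2|D2] := eqVneq D 2%N.
  by rewrite D2 mulrAC mulfV ?pnatr_eq0// mul1r cospi lt_eqF//; lra.
apply/orP; right; rewrite gt_eqF// sin_gt0_pi// divr_gt0 ?mulr_gt0//=.
rewrite ltr_pdivrMr// mulrC ltr_pM2l// ltr_nat.
by rewrite ltn_neqAle eq_sym D2.
Qed.

(** The exponent is the representative of [c] below D. By [omega_order] this is an additive
    character of F_D, faithful by [phase_eq1]. *)
Definition phase (c : F) : R[i] := w ^+ c.

Lemma phase_nat k : phase k%:R = w ^+ k.
Proof. by rewrite /phase val_Fp_nat// -[in RHS](expr_mod _ omega_order). Qed.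

Lemma phase0 : phase 0 = 1.
Proof. exact: (phase_nat 0). Qed.

Lemma phaseD a b : phase (a + b) = phase a * phase b.
Proof.
by rewrite -[a]natr_Zp -[b]natr_Zp -natrD !phase_nat exprD.
Qed.

Lemma phaseMn a k : phase (a *+ k) = phase a ^+ k.
Proof. by elim: k => [|k IH]; rewrite ?phase0// mulrS phaseD IH exprS. Qed.

Lemma phaseNM a : phase (- a) * phase a = 1.
Proof. by rewrite -phaseD addNr phase0. Qed.

Lemma phase_neq0 a : phase a != 0.
Proof. by apply: contra_eq_neq (phaseNM a) => ->; rewrite mulr0 eq_sym oner_eq0. Qed.

Lemma phaseN a : phase (- a) = (phase a)^-1.
Proof. by apply: (mulIf (phase_neq0 a)); rewrite phaseNM mulVf ?phase_neq0. Qed.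

(** A nonzero [a] is coprime to D, so Bezout gives u a = v D + 1, and [w] would be a power of w^a =
    1. *)
Lemma phase_eq1 a : phase a = 1 -> a = 0.
Proof.
move=> a1; apply/eqP; apply: contraT => a0.
have Da : coprime a D.
  rewrite coprime_sym prime_coprime//; apply: contra a0 => /dvdnP [k ak].
  by rewrite -[a]natr_Zp ak natrM pchar_Fp_0// mulr0.
case: (egcdnP D (m := a)); first by rewrite lt0n.
move=> u v uv _; move: omega_neq1 => /negP; case.
move: uv; rewrite (eqP Da) => uv.
have : w ^+ (u * a) = w by rewrite uv exprD mulnC exprM omega_order expr1n mul1r expr1.
by rewrite mulnC exprM -/(phase a) a1 expr1n => ->.
Qed.

Lemma phase_inj : injective phase.
Proof.
move=> a b ab; apply/eqP; rewrite -subr_eq0; apply/eqP/phase_eq1.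
by rewrite phaseD ab -phaseD subrr phase0.
Qed.

Lemma conj_phase a : (phase a)^* = phase (- a).
Proof.
have w1 : `|w| = 1.
  by apply/eqP; rewrite -(@pexpr_eq1 _ _ D) ?prime_gt0// -normrX omega_order normr1.
apply: (mulfI (phase_neq0 a)); rewrite -normCK -phaseD subrr phase0.
by rewrite /phase normrX w1 !expr1n.
Qed.

End Omega.

Section SquareMatrix.
Variables (K : comPzRingType) (m : nat).
Implicit Types (a : K) (A B : 'M[K]_m).

Lemma sqmxZl a A B : (a *: A) * B = a *: (A * B).
Proof. by rewrite -!mulmxE scalemxAl. Qed.

Lemma sqmxZr a A B : A * (a *: B) = a *: (A * B).
Proof. by rewrite -!mulmxE scalemxAr. Qed.
End SquareMatrix.

(** * Weyl operators over an abstract label group *)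

Section Weyl.
Variables (R : realType) (D m : nat) (G : zmodType).
Variables (lbl : 'I_m -> G) (idx : G -> 'I_m) (dot : G -> G -> 'F_D).
Hypothesis D_prime : prime D.
Hypotheses (lblK : cancel lbl idx) (idxK : cancel idx lbl).
Hypotheses (dotDl : forall a b c, dot (a + b) c = dot a c + dot b c).
Hypotheses (dotDr : forall a b c, dot a (b + c) = dot a b + dot a c).
Hypothesis dot_nondeg : forall b, b != 0 -> exists e, dot b e != 0.
Local Notation phase := (@phase R D).

(** For x = (a, b) this is X^a Z^b. Abstracting the label group lets the same lemmas serve a single
    qudit ([weyl1], labels in F_D) and all qudits together ([wop], labels in F_D^V). *)
Definition weyl (x : G * G) : 'M[R[i]]_m :=
  \matrix_(i, j) (phase (dot x.2 (lbl j)) *+ (lbl i == lbl j + x.1)).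

Lemma weylM x y : weyl x * weyl y = phase (dot x.2 y.1) *: weyl (x + y).
Proof.
case: x y => [a b] [a' b']; apply/matrixP => i k; rewrite !mxE /=.
rewrite (bigD1 (idx (lbl k + a'))) //= big1 ?addr0 => [|j jk].
  rewrite !mxE idxK eqxx mulr1n [a + a']addrC addrA mulrnAl mulrnAr; congr (_ *+ _).
  by rewrite -!phaseD// dotDr dotDl; congr phase; ring.
rewrite !mxE [lbl j == _](_ : _ = false) ?mulr0//.
by apply: contraNF jk => /eqP <-; rewrite lblK.
Qed.

Lemma dot0l a : dot 0 a = 0.
Proof. by apply: (addIr (dot 0 a)); rewrite -dotDl !add0r. Qed.

Lemma dot0r a : dot a 0 = 0.
Proof. by apply: (addIr (dot a 0)); rewrite -dotDr !add0r. Qed.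

Lemma dotNl a b : dot (- a) b = - dot a b.
Proof. by apply: (addIr (dot a b)); rewrite -dotDl !addNr dot0l. Qed.

Lemma weyl0 : weyl 0 = 1.
Proof.
apply/matrixP => i j; rewrite !mxE /= dot0l phase0// addr0.
by rewrite (inj_eq (can_inj lblK)).
Qed.

(** A nonzero shift leaves the diagonal empty. Without shift the trace is the sum of a nontrivial
    character: translating the labels by [e] multiplies it by a phase different from 1. *)
Lemma weyl_tr x : x != 0 -> \tr (weyl x) = 0.
Proof.
case: x => a b ab0; rewrite /mxtrace.
under eq_bigr do rewrite mxE /= -[X in X == _]addr0 (inj_eq (addrI _)) eq_sym.
have [a0|a0] := eqVneq a 0; last by rewrite big1.
have [|e be] := dot_nondeg (b := b).
  by apply: contra ab0 => /eqP b0; rewrite a0 b0.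
pose sh i := idx (lbl i + e).
have shI : injective sh.
  by move=> i j /(can_inj idxK)/addIr/(can_inj lblK).
under eq_bigr do rewrite mulr1n.
set s := \sum_i _; apply/eqP.
have : s == phase (dot b e) * s.
  rewrite mulr_sumr /s [eqbLHS](reindex_inj shI)/=; apply/eqP/eq_bigr => i _.
  by rewrite idxK dotDr addrC phaseD.
rewrite -subr_eq0 -{1}[s]mul1r -mulrBl mulf_eq0 => /orP[|//].
by rewrite subr_eq0 eq_sym => /eqP/phase_eq1 be0; rewrite be0// eqxx in be.
Qed.

Lemma weyl_adj x : map_mx Num.conj (weyl x)^T * weyl x = 1.
Proof.
have -> : map_mx Num.conj (weyl x)^T = phase (dot x.2 x.1) *: weyl (- x).
  case: x => a b; apply/matrixP => i j; rewrite !mxE /= dotNl.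
  rewrite rmorphMn/= conj_phase// mulrnAr -phaseD//.
  rewrite [lbl i == _]eq_sym subr_eq; have [->|//] := eqVneq (lbl j) (lbl i + a).
  by congr (phase _ *+ _); rewrite dotDr opprD addrCA subrr addr0.
by rewrite sqmxZl weylM addNr weyl0 scalerA -phaseD// dotNl subrr phase0// scale1r.
Qed.

(** Appending one factor to j others costs j times the basic phase; the costs 0 + 1 + ... + (k - 1)
    add up to the binomial. *)
Lemma weyl_exp x k : weyl x ^+ k = phase (dot x.2 x.1 *+ 'C(k, 2)) *: weyl (x *+ k).
Proof.
elim: k => [|k IH]; first by rewrite expr0 mulr0n phase0// scale1r weyl0.
rewrite exprSr IH sqmxZl weylM scalerA -phaseD// -mulrSr; congr (phase _ *: _).
have dotMn a b j : dot (a *+ j) b = dot a b *+ j.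
  by elim: j => [|j IHj]; rewrite ?dot0l// !mulrS dotDl IHj.
have -> : (x *+ k).2 = x.2 *+ k by elim: k {IH} => [|j IHj]//; rewrite !mulrS /= IHj.
by rewrite dotMn -mulrnDr binS bin1.
Qed.

End Weyl.

(** * Single-qudit Paulis as Weyl operators *)

Section Site.
Variables (R : realType) (D : nat).
Hypothesis D_prime : prime D.
Local Notation F := 'F_D.

Lemma ltn_Fp (x : F) : (x < D)%N.
Proof. by rewrite -[ltnRHS](Fp_cast D_prime) ltn_ord. Qed.

Definition of_Fp (x : F) : 'I_D := Ordinal (ltn_Fp x).
Definition to_Fp (i : 'I_D) : F := i%:R.

Lemma to_FpK : cancel to_Fp of_Fp.
Proof. by move=> i; apply: val_inj; rewrite /= val_Fp_nat// modn_small. Qed.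

Lemma of_FpK : cancel of_Fp to_Fp.
Proof. by move=> x; apply: natr_Zp. Qed.

Definition mulF (a b : F) : F := a * b.

Lemma mulFDl a b c : mulF (a + b) c = mulF a c + mulF b c.
Proof. exact: mulrDl. Qed.

Lemma mulFDr a b c : mulF a (b + c) = mulF a b + mulF a c.
Proof. exact: mulrDr. Qed.

Definition weyl1 : F * F -> 'M[R[i]]_D := weyl R to_Fp mulF.

Lemma weyl1_0 : weyl1 0 = 1.
Proof. exact (weyl0 R D_prime to_FpK mulFDl). Qed.

Lemma weyl1M x y : weyl1 x * weyl1 y = phase R (x.2 * y.1) *: weyl1 (x + y).
Proof. exact (weylM R D_prime to_FpK of_FpK mulFDl mulFDr x y). Qed.

Lemma pauliE ab : pauli R ab = weyl1 (ab.1%:R, ab.2%:R).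
Proof.
have X : shiftX R D = weyl1 (1, 0).
  apply/matrixP => i j; rewrite !mxE /mulF mul0r phase0//; congr (_ *+ nat_of_bool _).

  rewrite /= /to_Fp natr1 -val_eqE /= !val_Fp_nat//.
  by rewrite [(i %% D)%N]modn_small.
have Z : clockZ R D = weyl1 (0, 1).
  apply/matrixP => i j; rewrite !mxE /mulF mul1r addr0 (can_eq to_FpK) /to_Fp.
  by rewrite phase_nat.
have Xk k : shiftX R D ^+ k = weyl1 (k%:R, 0).
  elim: k => [|k IH]; first by rewrite expr0 -weyl1_0.
  rewrite exprS IH X weyl1M mul0r phase0// scale1r ; congr weyl1.
  by apply: injective_projections; rewrite /= ?addr0// nat1r.
have Zk k : clockZ R D ^+ k = weyl1 (0, k%:R).
  elim: k => [|k IH]; first by rewrite expr0 -weyl1_0.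
  rewrite exprS IH Z weyl1M mulr0 phase0// scale1r ; congr weyl1.
  by apply: injective_projections; rewrite /= ?addr0// nat1r.
rewrite /pauli Xk Zk weyl1M mul0r phase0// scale1r; congr weyl1.
by apply: injective_projections; rewrite /= ?addr0 ?add0r.
Qed.
End Site.

(** * Weyl operators on all qudits *)

Section Tensor.
Variables (R : realType) (D : nat) (V : finType).
Hypothesis D_prime : prime D.
Local Notation F := 'F_D.
Local Notation G := {ffun V -> F}.
Local Notation W := (G * G)%type.
Local Notation N := (hdim V D).

Definition lblV (i : 'I_N) : G := [ffun v => to_Fp ((enum_val i : {ffun V -> 'I_D}) v)].
Definition idxV (a : G) : 'I_N := enum_rank [ffun v => of_Fp D_prime (a v)].

Lemma lblVK : cancel lblV idxV.
Proof.
move=> i; rewrite /idxV -[RHS]enum_valK; congr enum_rank.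
by apply/ffunP => v; rewrite !ffunE to_FpK.
Qed.

Lemma idxVK : cancel idxV lblV.
Proof.
by move=> a; apply/ffunP => v; rewrite ffunE enum_rankK ffunE of_FpK.
Qed.

Definition dot (a b : G) : F := \sum_v a v * b v.

Lemma dotDl a b c : dot (a + b) c = dot a c + dot b c.
Proof. by rewrite /dot -big_split; apply: eq_bigr => v _; rewrite ffunE mulrDl. Qed.

Lemma dotDr a b c : dot a (b + c) = dot a b + dot a c.
Proof. by rewrite /dot -big_split; apply: eq_bigr => v _; rewrite ffunE mulrDr. Qed.

Lemma dot_nondeg (b : G) : b != 0 -> exists e, dot b e != 0.
Proof.
move=> b0; have [v bv] : exists v, b v != 0.
  apply/existsP; apply: contraNT b0; rewrite negb_exists => /forallP b0.
  by apply/eqP/ffunP => v; rewrite ffunE; apply/eqP; move: (b0 v); rewrite negbK.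
exists [ffun u => (u == v)%:R]; rewrite /dot (bigD1 v)//= big1 => [|u /negPf uv].
  by rewrite ffunE eqxx mulr1 addr0.
by rewrite ffunE uv mulr0.
Qed.

Definition wop : W -> 'M[R[i]]_N := weyl R lblV dot.

(* The commutation function c of the single-qudit Paulis, summed over the qudits. *)
Definition sp (x y : W) : F := dot x.2 y.1 - dot y.2 x.1.

Lemma wopM x y : wop x * wop y = phase R (dot x.2 y.1) *: wop (x + y).
Proof. exact (weylM R D_prime lblVK idxVK dotDl dotDr x y). Qed.

Lemma wop0 : wop 0 = 1.
Proof. exact (weyl0 R D_prime lblVK dotDl). Qed.

Lemma wop_tr (x : W) : x != 0 -> \tr (wop x) = 0.
Proof. exact (weyl_tr R D_prime lblVK idxVK dotDr dot_nondeg (x := x)). Qed.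

Lemma wop_adj x : map_mx Num.conj (wop x)^T * wop x = 1.
Proof. exact (weyl_adj R D_prime lblVK idxVK dotDl dotDr x). Qed.

Lemma wop_exp x k : wop x ^+ k = phase R (dot x.2 x.1 *+ 'C(k, 2)) *: wop (x *+ k).
Proof. exact (weyl_exp R D_prime lblVK idxVK dotDl dotDr x k). Qed.

Lemma wop_comm x y : wop x * wop y = phase R (sp x y) *: (wop y * wop x).
Proof. by rewrite !wopM scalerA -phaseD// subrK addrC. Qed.

Lemma hdim_gt0 : (0 < N)%N.
Proof.
apply/card_gt0P; exists [ffun => Ordinal (prime_gt0 D_prime)].
by [].
Qed.

Lemma mx1_neq0 : 1 != 0 :> 'M[R[i]]_N.
Proof.
apply/eqP => /matrixP /(_ (Ordinal hdim_gt0) (Ordinal hdim_gt0)) /eqP.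
by rewrite !mxE eqxx oner_eq0.
Qed.

(** For a nonzero label the trace is zero, so [b] and with it [wop x] would vanish, although [wop x]
    is unitary. Through [wop_inj], an operator then determines its label even up to a nonzero
    factor. *)
Lemma wop_scalar (x : W) (a b : R[i]) : a != 0 -> a *: wop x = b *: (1 : 'M[R[i]]_N) -> x = 0.
Proof.
move=> a0 xb; apply/eqP; apply: contraTT isT => x0.
move: (congr1 mxtrace xb); rewrite !mxtraceZ wop_tr// mulr0.
move/esym/eqP; rewrite mulf_eq0 mxtrace1 pnatr_eq0 eqn0Ngt hdim_gt0 orbF => /eqP b0.
move: xb; rewrite b0 scale0r => /eqP; rewrite scaler_eq0 (negPf a0) /= => /eqP wx0.
by move: (wop_adj x) => /eqP; rewrite wx0 mulr0 eq_sym (negPf mx1_neq0).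
Qed.

Lemma wop_inj (x y : W) (a b : R[i]) : a != 0 -> a *: wop x = b *: wop y -> x = y.
Proof.
move=> a0 /(congr1 (fun A => A * wop (- y))); rewrite !sqmxZl !wopM !scalerA subrr wop0.
by move/wop_scalar => /(_ (mulf_neq0 a0 (phase_neq0 _ _ _)))/eqP; rewrite subr_eq0 => /(_ _)/eqP ->.
Qed.

Definition site (v : V) (x : F * F) : W :=
  ([ffun u => x.1 *+ (u == v)], [ffun u => x.2 *+ (u == v)]).

Lemma on_site_weyl1 v x : on_site (weyl1 R x) v = wop (site v x).
Proof.
apply/matrixP => i j; rewrite !mxE /=.
transitivity (\prod_(u : V)
   (phase R (mulF ((site v x).2 u) (lblV j u)) *+ (lblV i u == lblV j u + (site v x).1 u))).
  apply: eq_bigr => u _; rewrite !ffunE; case: eqP => _.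
    by rewrite !mxE !mulr1n.
  by rewrite -(weyl1_0 R D_prime) !mxE.
(* Matching configurations give a product of phases; otherwise some site contributes a zero
   factor. *)
set e := lblV i == _; rewrite /dot.
have -> : phase R (\sum_u (site v x).2 u * lblV j u) = \prod_u phase R ((site v x).2 u * lblV j u).
  exact: (big_morph _ (phaseD R D_prime) (phase0 R D_prime)).
have [/eqP -> |ne] := boolP e.
  by rewrite mulr1n; apply: eq_bigr => u _; rewrite !ffunE eqxx mulr1n.
have [u ue] : exists u, lblV i u != lblV j u + (site v x).1 u.
  apply/existsP; apply: contraNT ne; rewrite negb_exists => /forallP ne.
  by apply/eqP/ffunP => u; rewrite [RHS]ffunE; apply/eqP; move: (ne u); rewrite negbK.
by rewrite (bigD1 u) //; move: ue => /negPf ->; rewrite /= !mulr0n mul0r.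
Qed.

Lemma on_siteZ (a : R[i]) (A : 'M[R[i]]_D) (v : V) : on_site (a *: A) v = a *: on_site A v.
Proof.
apply/matrixP => i j; rewrite !mxE (bigD1 v)//= [in RHS](bigD1 v)//= eqxx mxE mulrA.
by congr (_ * _); apply: eq_bigr => u /negPf ->.
Qed.

Definition exp_site (v : V) (ab : 'I_D * 'I_D) : W := site v (ab.1%:R, ab.2%:R).

Lemma on_site_pauli v ab : on_site (pauli R ab) v = wop (exp_site v ab).
Proof. by rewrite pauliE// on_site_weyl1. Qed.

Lemma dot_site2 v x (a : G) : dot (site v x).2 a = x.2 * a v.
Proof.
rewrite /dot (bigD1 v)//= big1 => [|u /negPf uv]; first by rewrite ffunE eqxx mulr1n addr0.
by rewrite ffunE uv mulr0n mul0r.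
Qed.

Lemma dot_site1 v x (a : G) : dot a (site v x).1 = a v * x.1.
Proof.
rewrite /dot (bigD1 v)//= big1 => [|u /negPf uv]; first by rewrite ffunE eqxx mulr1n addr0.
by rewrite ffunE uv mulr0n mulr0.
Qed.

Lemma on_site_pauliM v u ab ab' : v != u ->
  on_site (pauli R ab) v * on_site (pauli R ab') u = wop (exp_site v ab + exp_site u ab').
Proof.
move=> vu; rewrite !on_site_pauli wopM dot_site2 /= ffunE (negPf vu) mulr0n mulr0.
by rewrite phase0// scale1r.
Qed.

End Tensor.

Lemma sum_phase (R : realType) (D : nat) (D_prime : prime D) (b : 'F_D) :
  \sum_c phase R (c * b) = D%:R *+ (b == 0).
Proof.
have [->|b0] := eqVneq b 0.
  under eq_bigr do rewrite mulr0 phase0//.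
  by rewrite sumr_const card_Fp// mulr1n.
rewrite mulr0n; set s := \sum_c _; apply/eqP.
have : s == phase R b * s.
  rewrite mulr_sumr /s [eqbLHS](reindex_inj (addrI 1))/=; apply/eqP/eq_bigr => c _.
  by rewrite mulrDl mul1r phaseD.
rewrite -subr_eq0 -{1}[s]mul1r -mulrBl mulf_eq0 => /orP[|//].
by rewrite subr_eq0 eq_sym => /eqP/phase_eq1 b00; rewrite b00// eqxx in b0.
Qed.

(** * Adjoints, idempotents and ranks *)

Section Adjoint.
Variables (R : realType) (m : nat).
Implicit Types (A B : 'M[R[i]]_m).

Definition adjmx A := map_mx Num.conj A^T.

Lemma adjmxM A B : adjmx (A * B) = adjmx B * adjmx A.
Proof. by rewrite /adjmx -mulmxE trmx_mul map_mxM. Qed.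

Lemma adjmxK A : adjmx (adjmx A) = A.
Proof. by apply/matrixP => i j; rewrite !mxE conjCK. Qed.

Lemma adjmxZ a A : adjmx (a *: A) = a^* *: adjmx A.
Proof. by apply/matrixP => i j; rewrite !mxE rmorphM. Qed.

Lemma adjmx_sum (I : finType) (f : I -> 'M[R[i]]_m) :
  adjmx (\sum_i f i) = \sum_i adjmx (f i).
Proof.
apply/matrixP => i j; rewrite !(mxE, summxE) rmorph_sum.
by apply: eq_bigr => k _; rewrite !mxE.
Qed.

(** In the rank factorization A = C B, idempotence forces B C to be the identity of size rank A, and
    the trace is cyclic. *)
Lemma projector_mxtrace A : A * A = A -> \tr A = (\rank A)%:R.
Proof.
move=> AA; rewrite -{1}(mulmx_base A) mxtrace_mulC.
suff -> : row_base A *m col_base A = 1%:M by rewrite mxtrace1.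
have [C CB] : exists C, C *m col_base A = 1%:M.
  by exists (pinvmx (col_base A)); rewrite mulVpmx// -?row_full_def ?col_base_full//; exact: col_base_full.
have [C' BC'] : exists C', row_base A *m C' = 1%:M.
  by exists (pinvmx (row_base A)); rewrite mulmxVp ?row_base_free.
move: AA; rewrite -mulmxE -{1 2 3}(mulmx_base A) => AA.
have /= := congr1 (fun X => C *m X *m C') AA.
move: (col_base A) (row_base A) CB BC' => B B' CB BC'.
rewrite !mulmxA CB mul1mx -[_ *m B' *m C']mulmxA BC' mulmx1.
by [].
Qed.
End Adjoint.

Lemma eq_mulmx_cV (K : pzRingType) m n (A B : 'M[K]_(m, n)) :
  (forall psi : 'cV_n, A *m psi = B *m psi) -> A = B.
Proof.
move=> AB; apply/matrixP => i j; move: (AB (delta_mx j 0)).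
by rewrite -!colE => /matrixP /(_ i 0); rewrite !mxE.
Qed.

(** * Spectral projectors of a unitary operator of order D *)

Section Projector.
Variables (R : realType) (D : nat) (V : finType).
Hypothesis D_prime : prime D.
Local Notation F := 'F_D.
Local Notation op := 'M[R[i]]_(hdim V D).
Local Notation phase := (@phase R D).
Variable P : op.
Hypotheses (P_order : P ^+ D = 1) (P_unitary : adjmx P * P = 1).

Lemma expFp_D (a b : F) : P ^+ (a + b)%R = P ^+ a * P ^+ b.
Proof.
have PE k : P ^+ (k%:R : F) = P ^+ k.
  by rewrite val_Fp_nat// {2}(divn_eq k D) exprD mulnC exprM P_order expr1n mul1r.
by rewrite -[a]natr_Zp -[b]natr_Zp -natrD !PE exprD.
Qed.

(** The Fourier average projecting onto the eigenvalue [phase c]. Being a polynomial in [P], it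
    commutes with whatever commutes with [P]. *)
Definition eigproj (c : F) : op := D%:R^-1 *: \sum_(b : F) phase (- (c * b)) *: P ^+ b.

Local Notation Q c := (phase (- c) *: P).

Lemma D_neq0 : D%:R != 0 :> R[i].
Proof. by rewrite pnatr_eq0 -lt0n prime_gt0. Qed.

Lemma Q_eigproj c : Q c * eigproj c = eigproj c.
Proof.
have P1 : P ^+ (1%R : F) = P by rewrite (val_Fp_nat D_prime 1) modn_small ?prime_gt1// expr1.
rewrite /eigproj sqmxZr; congr (_ *: _); rewrite mulr_sumr.
rewrite [RHS](reindex_inj (addrI 1)); apply: eq_bigr => b _.
rewrite sqmxZl sqmxZr scalerA expFp_D P1; congr (_ *: _).
by rewrite -phaseD// mulrDr mulr1 opprD.
Qed.

Lemma eigproj_fix c (psi : 'cV_(hdim V D)) : Q c *m psi = psi -> eigproj c *m psi = psi.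
Proof.
move=> Qpsi; rewrite /eigproj -scalemxAl mulmx_suml.
under eq_bigr => b _.
  have -> : phase (- (c * b)) *: P ^+ b *m psi = psi.
    rewrite -{1}[b]natr_Zp mulr_natr -mulNrn phaseMn//.
    elim: (b : nat) => [|k IH]; first by rewrite !expr0 scale1r mul1mx.
    rewrite !exprS -scalerA -sqmxZr -sqmxZl -mulmxE -mulmxA IH //.
  over.
by rewrite sumr_const card_Fp// -[psi *+ D]scaler_nat scalerA mulVf ?D_neq0// scale1r.
Qed.

Lemma eigproj_idem c : eigproj c * eigproj c = eigproj c.
Proof.
apply: eq_mulmx_cV => psi; rewrite -mulmxE -mulmxA.
by apply: eigproj_fix; rewrite mulmxA mulmxE Q_eigproj.
Qed.

(** Write E for [eigproj c]. The adjoints of the powers of [Q c] fix E, so [adjmx E * E = E], and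
    the left side is self-adjoint. *)
Lemma eigproj_adj c : adjmx (eigproj c) = eigproj c.
Proof.
have QQ : adjmx (Q c) * Q c = 1.
  rewrite adjmxZ sqmxZl sqmxZr scalerA P_unitary.
  by rewrite conj_phase// -phaseD// opprK subrr phase0// scale1r.
have Qa : adjmx (Q c) * eigproj c = eigproj c.
  by rewrite -{1}Q_eigproj mulrA QQ mul1r.
have QbE (b : F) : phase (- (c * b)) *: P ^+ b = Q c ^+ b.
  rewrite -{1}[b]natr_Zp mulr_natr -mulNrn phaseMn//.
  elim: (b : nat) => [|k IH]; first by rewrite !expr0 scale1r.
  by rewrite !exprS -IH sqmxZl sqmxZr scalerA.
have aE : adjmx (eigproj c) * eigproj c = eigproj c.
  rewrite {1}/eigproj adjmxZ adjmx_sum sqmxZl mulr_suml.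
  under eq_bigr => b _.
    have -> : adjmx (phase (- (c * b)) *: P ^+ b) * eigproj c = eigproj c.
      rewrite QbE; elim: (b : nat) => [|k IH].
        by rewrite expr0 -{2}[eigproj c]mul1r; congr (_ * _); rewrite /adjmx trmx1 map_mx1.
      by rewrite exprS adjmxM -mulrA Qa.
    over.
  rewrite sumr_const card_Fp// -[eigproj c *+ D]scaler_nat scalerA rmorphV ?unitfE ?D_neq0//.
  by rewrite rmorph_nat mulVf ?D_neq0// scale1r.
by rewrite -{1}aE adjmxM adjmxK.
Qed.

Lemma sum_eigproj : \sum_c eigproj c = 1.
Proof.
rewrite /eigproj -scaler_sumr exchange_big /=.
under eq_bigr => b _.
  rewrite -scaler_suml; under eq_bigr do rewrite -mulrN.
  rewrite sum_phase// oppr_eq0; over.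
rewrite (bigD1 0)//= big1 => [|b /negPf ->]; last by rewrite mulr0n scale0r.
by rewrite ?eqxx mulr1n expr0 addr0 scalerA mulVf ?D_neq0// scale1r.
Qed.

Lemma eigproj_eigenprojector (o : 'I_D) : eigenprojector P o (eigproj (to_Fp o)).
Proof.
have wE : omega R D ^+ o = phase (to_Fp o) by rewrite phase_nat.
split; [exact: eigproj_idem | exact: eigproj_adj | move=> psi; rewrite wE; split].
- move=> <-; rewrite -{2}Q_eigproj sqmxZl -[_ *: (P * _) *m psi]scalemxAl scalerA.
  by rewrite -phaseD// subrr phase0// scale1r -mulmxE mulmxA.
- move=> Ppsi; apply: eigproj_fix; rewrite -scalemxAl Ppsi scalerA -phaseD//.
  by rewrite addNr phase0// scale1r.
Qed.

(** Two self-adjoint idempotents with the same range coincide: each absorbs the other on one side,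
    and taking adjoints swaps the sides. This makes the abstract projector of [possible_outcome] a
    polynomial in [P]. *)
Lemma eigenprojectorE (o : 'I_D) (Pi : op) : eigenprojector P o Pi -> Pi = eigproj (to_Fp o).
Proof.
case: (eigproj_eigenprojector o) => i1 a1 e1 [i2 a2 e2].
have range (A B : op) : B * B = B -> (forall psi : 'cV_(hdim V D), B *m psi = psi -> A *m psi = psi) -> A * B = B.
  move=> BB AB; apply: eq_mulmx_cV => psi; rewrite -mulmxE -mulmxA.
  by apply: AB; rewrite mulmxA mulmxE BB.
have e12 : eigproj (to_Fp o) * Pi = Pi.
  by apply: range => // psi /e2/e1.
have e21 : Pi * eigproj (to_Fp o) = eigproj (to_Fp o).
  by apply: range => // psi /e1/e2.
by move: (congr1 (@adjmx _ _) e21); rewrite adjmxM /adjmx a1 a2 e12.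
Qed.

Lemma eigproj_comm (A : op) c : A * P = P * A -> A * eigproj c = eigproj c * A.
Proof.
move=> AP; rewrite /eigproj sqmxZr sqmxZl mulr_sumr mulr_suml; congr (_ *: _).
apply: eq_bigr => b _; rewrite sqmxZr sqmxZl; congr (_ *: _).
exact/commrX.
Qed.

End Projector.

(** * The symplectic space of labels *)

Section Symplectic.
Variables (D : nat) (V : finType).
Hypothesis D_prime : prime D.
Local Notation F := 'F_D.
Local Notation G := {ffun V -> F}.
Local Notation W := (G * G)%type.

Lemma spDl (x y z : W) : sp (x + y) z = sp x z + sp y z.
Proof. by rewrite /sp /= dotDl dotDr; ring. Qed.

Lemma spDr (x y z : W) : sp x (y + z) = sp x y + sp x z.
Proof. by rewrite /sp /= dotDl dotDr; ring. Qed.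

Lemma sp0l (x : W) : sp 0 x = 0.
Proof. by apply: (addrI (sp 0 x)); rewrite -spDl !addr0. Qed.

Lemma spNl (x y : W) : sp (- x) y = - sp x y.
Proof. by apply: (addrI (sp x y)); rewrite -spDl !subrr sp0l. Qed.

Lemma spMnl (x y : W) k : sp (x *+ k) y = sp x y *+ k.
Proof.
elim: k => [|k IH]; last by rewrite !mulrS spDl IH.
by rewrite !mulr0n sp0l.
Qed.

Lemma WmulnD (x : W) : x *+ D = 0.
Proof.
have FD (c : F) : c *+ D = 0 by rewrite -mulr_natr pchar_Fp_0// mulr0.
have GD (a : G) : a *+ D = 0.
  have aE k v : (a *+ k) v = a v *+ k by elim: k => [|k IH]; rewrite ?ffunE// !mulrS ffunE IH.
  by apply/ffunP => v; rewrite aE FD ffunE.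
have xE k : x *+ k = (x.1 *+ k, x.2 *+ k).
  by elim: k => [|k IH] //; rewrite !mulrS IH; apply: injective_projections.
by rewrite xE !GD.
Qed.

(** Natural multiples stand in for scalars of F_D throughout, so negatives have to be natural
    multiples too. *)
Lemma WmulnN (x : W) k : - (x *+ k) = x *+ (D * k - k).
Proof.
rewrite mulrnBr ?leq_pmull ?prime_gt0//.
by rewrite mulrnA WmulnD mul0rn add0r.
Qed.
End Symplectic.

(** * Stabilizer groups described by their labels *)

Section Stabilizer.
Variables (R : realType) (D : nat) (V : finType).
Hypothesis D_prime : prime D.
Local Notation F := 'F_D.
Local Notation G := {ffun V -> F}.
Local Notation W := (G * G)%type.
Local Notation N := (hdim V D).
Local Notation op := 'M[R[i]]_N.
Local Notation state := 'cV[R[i]]_N.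
Local Notation phase := (@phase R D).
Local Notation wop := (@wop R D V).

Lemma wop_neq0 (x : W) : wop x != 0.
Proof.
apply/eqP => wx0; move: (wop_adj R D_prime x) => /eqP.
by rewrite wx0 mulr0 eq_sym (negPf (mx1_neq0 _ _ D_prime)).
Qed.

Lemma mulr1_invmx (A B : op) : A * B = 1 -> invmx A = B.
Proof.
move=> AB; have [uA _] := mulmx1_unit AB.
by rewrite -[LHS]mulmx1 -[1%:M]AB -mulmxE mulKmx.
Qed.

Lemma generated_group (X : set op) : is_group (generated X).
Proof.
split=> [K [[K1 _ _] _]|A B gA gB K KX|A gA K KX] //.
- by case: (KX) => -[_ KM _] _; apply: KM; [exact: gA | exact: gB].
- by case: (KX) => -[_ _ KV] _; apply: KV; exact: gA.
Qed.

Lemma sub_generated (X : set op) : X `<=` generated X.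
Proof. by move=> A XA K [_ KX]; exact: KX. Qed.

Lemma group_exp (X : set op) A k : is_group X -> X A -> X (A ^+ k).
Proof.
case=> X1 XM _ XA; elim: k => [|k IH]; first by rewrite expr0.
by rewrite exprS; apply: XM.
Qed.

(** The phases are left existential, so [L] does not depend on outcomes. The last clause excludes
    nontrivial scalars, see [stab_wop_inj]. *)
Definition stab (S : set op) (L : W -> Prop) : Prop :=
  [/\ is_group S,
      (forall A, S A -> exists l x, L x /\ A = phase l *: wop x),
      (forall x, L x -> exists l, S (phase l *: wop x)) &
      exists2 psi, psi != 0 & codespace S psi].

Lemma stab_ext S (L L' : W -> Prop) : (forall x, L x <-> L' x) -> stab S L -> stab S L'.
Proof.
move=> LL' [gS SL LS nz]; split=> // [A /SL [l [x [Lx ->]]]|x /LL'/LS //].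
by exists l, x; split=> //; apply/LL'.
Qed.

Lemma phase_wop_mul l x l' x' :
  (phase l *: wop x) * (phase l' *: wop x')
    = phase (l + l' + dot x.2 x'.1) *: wop (x + x').
Proof.
rewrite sqmxZl sqmxZr wopM// !scalerA; congr (_ *: _).
by rewrite !phaseD// mulrA.
Qed.

Lemma phase_wop_inv l x : invmx (phase l *: wop x) = phase (dot x.2 x.1 - l) *: wop (- x).
Proof.
apply: mulr1_invmx; rewrite phase_wop_mul subrr wop0// -[RHS]scale1r -(phase0 R D_prime).
congr (phase _ *: _).
have -> : dot x.2 (- x).1 = - dot x.2 x.1.
  by apply: (addrI (dot x.2 x.1)); rewrite -dotDr /= !subrr; exact: (dot0r (@dotDr D V)).
by ring.
Qed.

Lemma group_mul_closed (L : W -> Prop) : L 0 -> (forall x y, L x -> L y -> L (x + y)) ->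
  (forall x, L x -> L (- x)) ->
  is_group [set A | exists l x, L x /\ A = phase l *: wop x].
Proof.
move=> L0 LD LN; split.
- by exists 0, 0; rewrite phase0// scale1r wop0.
- move=> A B [l [x [Lx ->]]] [l' [x' [Lx' ->]]].
  by rewrite phase_wop_mul; exists (l + l' + dot x.2 x'.1), (x + x'); split=> //; exact: LD.
- move=> A [l [x [Lx ->]]]; rewrite phase_wop_inv.
  by exists (dot x.2 x.1 - l), (- x); split=> //; exact: LN.
Qed.

(** Used to see that a generated group fixes a vector once its generators do. A singular matrix is
    its own [invmx], which settles the inverse clause for it. *)
Lemma fixer_group (psi : state) : is_group [set A : op | A *m psi = psi].
Proof.
split=> /= [|A B Ap Bp|A Ap]; first exact: mul1mx.
- by rewrite -mulmxE -mulmxA Bp.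
- have [uA|uA] := boolP (A \in unitmx); first by rewrite -{1}Ap mulKmx.
  by rewrite invmx_out.
Qed.

Section Facts.
Variables (S : set op) (L : W -> Prop).
Hypothesis SL : stab S L.

Lemma stab_wop_inj a b x : S (a *: wop x) -> S (b *: wop x) -> a = b.
Proof.
case: SL => -[S1 SM SV] _ _ [psi psi0 Spsi] Sa Sb.
apply/eqP; rewrite -subr_eq0; apply: contraNT psi0 => ab.
have: (a - b) *: (wop x *m psi) = 0.
  by rewrite scalerBl !scalemxAl (Spsi _ Sa) (Spsi _ Sb) subrr.
move/eqP; rewrite scaler_eq0 (negPf ab) /= => /eqP wp0.
by rewrite -(Spsi _ Sa) -scalemxAl wp0 scaler0.
Qed.

Lemma stab_mem l x : S (phase l *: wop x) -> L x.
Proof.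
case: SL => _ H _ _ /H [l' [x' [Lx']]].
by move/(wop_inj D_prime (phase_neq0 R D_prime l)) => ->.
Qed.

Lemma stab0 : L 0.
Proof.
have [[S1 _ _] _ _ _] := SL.
by apply: (@stab_mem 0); rewrite phase0// scale1r wop0.
Qed.

Lemma stabD x y : L x -> L y -> L (x + y).
Proof.
have [[_ SM _] _ H _] := SL; move=> /H[l Sx] /H[l' Sy].
by have := SM _ _ Sx Sy; rewrite phase_wop_mul => /stab_mem.
Qed.

Lemma stabN x : L x -> L (- x).
Proof.
have [[_ _ SV] _ H _] := SL; move=> /H[l Sx].
by have := SV _ Sx; rewrite phase_wop_inv => /stab_mem.
Qed.

(** Upper bound: the new labels form a subgroup, so their phased operators form a group containing
    the generators. Lower bound: multiply a commuting element of [S] by a power of the measured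
    operator. *)
Lemma stab_update (y : W) (o : 'I_D) : wop y ^+ D = 1 -> possible_outcome S (wop y) o ->
  stab (update (wop y) o S) (fun z => exists x k, [/\ L x, sp x y = 0 & z = x + y *+ k]).
Proof.
move=> yD [Pi [psi [Pi_proj Spsi nz]]].
rewrite /update; set X := (X in generated X); set L' := (L' in stab _ L').
have oE : omega R D ^- o = phase (- to_Fp o).
  by rewrite phaseN// phase_nat.
have S_comm l x : L x -> (phase l *: wop x) * wop y = wop y * (phase l *: wop x) <-> sp x y = 0.
  move=> Lx; rewrite sqmxZl sqmxZr wop_comm// scalerA; split=> [|->]; last first.
    by rewrite phase0// mulr1.
  rewrite !wopM// !scalerA [y + x]addrC => /eqP; rewrite -subr_eq0 -scalerBl.
  rewrite scaler_eq0 (negPf (wop_neq0 _)) orbF.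
  rewrite -!phaseD// subr_eq0 => /eqP/(phase_inj D_prime).
  by move/addIr; rewrite -[RHS]addr0 => /addrI.
have L'0 : L' 0.
  exists 0, 0%N; split; [exact: stab0 | | by rewrite addr0].
  by rewrite sp0l.
have L'D x1 x2 : L' x1 -> L' x2 -> L' (x1 + x2).
  move=> [x [k [Lx xy ->]]] [x' [k' [Lx' xy' ->]]]; exists (x + x'), (k + k')%N.
  by split; [exact: stabD | rewrite spDl xy xy' addr0 | rewrite mulrnDr addrACA].
have L'N x1 : L' x1 -> L' (- x1).
  move=> [x [k [Lx xy ->]]]; exists (- x), (D * k - k)%N.
  split; [exact: stabN | | by rewrite opprD WmulnN].
  by rewrite spNl xy oppr0.
split.
- exact: generated_group.
- move=> A /(_ [set B | exists l x, L' x /\ B = phase l *: wop x]); apply; split.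
    exact: group_mul_closed.
  move=> B [->|[SB BP]].
    exists (- to_Fp o), y; rewrite oE; split=> //.
    exists 0, 1%N; split; [exact: stab0 | | by rewrite add0r].
    by rewrite sp0l.
  have [_ /(_ _ SB) [l [x [Lx BE]]] _ _] := SL.
  exists l, x; split=> //; exists x, 0%N; split=> //; last by rewrite addr0.
  by apply/(S_comm l x Lx); rewrite -BE.
- move=> z [x [k [Lx xy ->]]].
  have [_ _ /(_ _ Lx) [l Sx] _] := SL.
  have gx : generated X (phase l *: wop x).
    by apply: sub_generated; right; split=> //; exact/(S_comm l x Lx).
  have gy1 : generated X (phase (- to_Fp o) *: wop y).
    by apply: sub_generated; left; rewrite oE.
  have gy := group_exp k (generated_group X) gy1.
  have [c cE] : exists c, (phase (- to_Fp o) *: wop y) ^+ k = phase c *: wop (y *+ k).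
    elim: k {gy} => [|k [c IH]]; first by exists 0; rewrite expr0 phase0// scale1r wop0.
    by rewrite exprS IH phase_wop_mul -mulrS; eexists; reflexivity.
  have [_ gM _] := generated_group X.
  have := gM _ _ gx gy; rewrite cE phase_wop_mul => H.
  by eexists; exact: H.
(* The projected state is nonzero because the outcome is possible. It is an eigenvector of the
   measured operator, and elements of [S] commuting with that operator commute with [Pi] and still
   fix it. *)
- exists (Pi *m psi) => // A /(_ [set B | B *m (Pi *m psi) = Pi *m psi]); apply; split.
    exact: fixer_group.
  have [PiPi _ PiE] := Pi_proj.
  have PiPi' : Pi *m (Pi *m psi) = Pi *m psi by rewrite mulmxA mulmxE PiPi.
  move=> B [->|[SB BP]] /=.
    rewrite -scalemxAl; move/PiE: PiPi' => ->.
    by rewrite scalerA mulVf ?scale1r// expf_neq0// -[omega R D]expr1 -(phase_nat R D_prime) phase_neq0.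
  rewrite (eigenprojectorE D_prime yD (wop_adj R D_prime y) Pi_proj).
  by rewrite mulmxA mulmxE eigproj_comm// -mulmxE -mulmxA (Spsi _ SB).
Qed.

(** The spectral projectors sum to 1, so they cannot all kill a nonzero code vector. *)
Lemma possible_outcome_ex (y : W) : wop y ^+ D = 1 -> exists o, possible_outcome S (wop y) o.
Proof.
move=> yD; have [_ _ _ [psi psi0 Spsi]] := SL.
have [c pc] : exists c, eigproj (wop y) c *m psi != 0.
  apply/existsP; apply: contraNT psi0; rewrite negb_exists => /forallP H.
  rewrite -[psi]mul1mx -[1%:M](sum_eigproj D_prime (wop y)) mulmx_suml big1// => c _.
  by apply/eqP; move: (H c); rewrite negbK.
exists (of_Fp D_prime c), (eigproj (wop y) c), psi; split=> //.
by rewrite -{2}[c](of_FpK D_prime); apply: eigproj_eigenprojector => //; exact: wop_adj.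
Qed.

End Facts.

Lemma stab_start : stab [set A | A = 1] (fun x => x = 0).
Proof.
split.
- split=> //= [A B -> ->|A ->]; first by rewrite mulr1.
  by apply: mulr1_invmx; rewrite mulr1.
- by move=> A ->; exists 0, 0; rewrite phase0// scale1r wop0.
- by move=> x ->; exists 0; rewrite /= phase0// scale1r wop0.
- exists (const_mx 1).
    apply/eqP => /matrixP /(_ (Ordinal (hdim_gt0 V D_prime)) 0) /eqP.
    by rewrite !mxE oner_eq0.
  by move=> A ->; exact: mul1mx.
Qed.

End Stabilizer.

(** * Dimension of the code space *)

Section Dimension.
Variables (R : realType) (D : nat) (V : finType).
Hypothesis D_prime : prime D.
Local Notation F := 'F_D.
Local Notation G := {ffun V -> F}.
Local Notation W := (G * G)%type.
Local Notation N := (hdim V D).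
Local Notation op := 'M[R[i]]_N.
Local Notation state := 'cV[R[i]]_N.
Local Notation phase := (@phase R D).
Local Notation wop := (@wop R D V).

Lemma projector_has_dim (Pi : op) : Pi * Pi = Pi ->
  has_dim [set psi : state | Pi *m psi = psi] (\rank Pi).
Proof.
move=> PiPi; pose f : 'Hom('cV[R[i]]_(\rank Pi), state) := linfun (mulmx (col_base Pi)).
have fE u : f u = col_base Pi *m u by rewrite lfunE.
have [C CB] : exists C, C *m col_base Pi = 1%:M.
  by exists (pinvmx (col_base Pi)); rewrite mulVpmx// col_base_full.
have PB : Pi *m col_base Pi = col_base Pi.
  have [C' BC'] : exists C', row_base Pi *m C' = 1%:M.
    by exists (pinvmx (row_base Pi)); rewrite mulmxVp ?row_base_free.
  have colE : col_base Pi = Pi *m C'.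
    rewrite -[LHS]mulmx1 -BC' mulmxA; congr (_ *m _).
    exact: mulmx_base.
  by rewrite {1}colE mulmxA mulmxE PiPi -colE.
exists (limg f); split=> [psi|]; last first.
  rewrite limg_dim_eq ?dimvf//; first by rewrite /dim /= muln1.
  apply/eqP; rewrite -subv0; apply/subvP => u; rewrite memv_cap => /andP[_].
  rewrite memv_ker fE memv0 => /eqP fu; apply/eqP.
  by rewrite -[u]mul1mx -CB -mulmxA fu mulmx0.
split=> [/memv_imgP [u _ ->]|/= <-]; first by rewrite /= fE mulmxA PB.
apply/memv_imgP; exists (row_base Pi *m psi); first exact: memvf.
by rewrite fE mulmxA mulmx_base.
Qed.

Lemma has_dim_inj (U : set state) d d' : has_dim U d -> has_dim U d' -> d = d'.
Proof.
move=> [X [XU <-]] [X' [XU' <-]]; congr (\dim _).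
apply/vspaceP => psi; apply/idP/idP => [/XU/XU'|/XU'/XU] //.
Qed.

Lemma hdimE : N = (D ^ #|V|)%N.
Proof. by rewrite /hdim card_ffun card_ord. Qed.

(** Each label has exactly one phase in [S], so the chosen section [s] is multiplicative and
    enumerates [S]. In the trace of its average only the label 0 contributes. *)
Lemma stab_dim S (A : {set W}) d : stab S (fun x => x \in A) -> (d * #|A| = D ^ #|V|)%N ->
  has_dim (codespace (S : set op)) d.
Proof.
move=> SL dA.
have [[S1 SM SV] SP PS nz] := SL.
have [l lP] : exists l : W -> F, forall x, x \in A -> S (phase (l x) *: wop x).
  have : forall x, exists l, x \in A -> S (phase l *: wop x).
    by move=> x; have [/PS [l Sl]|_] := boolP (x \in A); [exists l | exists 0].
  by move/choice => -[l lP]; exists l.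
pose s x := phase (l x) *: wop x.
have sP B : S B -> exists2 x, x \in A & B = s x.
  move=> SB; have [l' [x [Ax BE]]] := SP _ SB; exists x => //.
  rewrite BE in SB *; congr (_ *: _); apply: (stab_wop_inj SL SB); exact: lP.
have sD x y : x \in A -> y \in A -> s x * s y = s (x + y).
  move=> Ax Ay; have := SM _ _ (lP _ Ax) (lP _ Ay).
  rewrite /s phase_wop_mul// => H; congr (_ *: _); apply: (stab_wop_inj SL H).
  by apply: lP; exact: (stabD D_prime SL).
have A0 : 0 \in A by exact: (stab0 D_prime SL).
have s0 : s 0 = 1.
  have [x Ax E1] := sP _ S1; rewrite E1; congr s; apply/esym.
  apply: (wop_scalar D_prime (phase_neq0 R D_prime (l x)) (b := 1)).
  by rewrite scale1r E1.
have cA : (#|A|%:R : R[i]) != 0.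
  by rewrite pnatr_eq0 -lt0n; apply/card_gt0P; exists 0.
pose Pi : op := #|A|%:R^-1 *: \sum_(x in A) s x.
have sPi x : x \in A -> s x * Pi = Pi.
  move=> Ax; rewrite /Pi sqmxZr mulr_sumr; congr (_ *: _).
  rewrite [RHS](reindex_inj (addrI x))/=; apply: eq_big => y; last first.
    by move=> Ay; exact: sD.
  apply/idP/idP => Ay; first exact: (stabD D_prime SL).
  by rewrite -[y](addKr x); apply: (stabD D_prime SL) => //; exact: (stabN D_prime SL).
have PiPi : Pi * Pi = Pi.
  rewrite {1}/Pi sqmxZl mulr_suml; under eq_bigr do rewrite sPi//.
  by rewrite sumr_const -[Pi *+ _]scaler_nat scalerA mulVf// scale1r.
have codeE : codespace S = [set psi : state | Pi *m psi = psi].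
  apply/seteqP; split=> psi /= psiP.
    rewrite /Pi -scalemxAl mulmx_suml; under eq_bigr => x Ax do rewrite (psiP _ (lP _ Ax)).
    by rewrite sumr_const -[psi *+ _]scaler_nat scalerA mulVf// scale1r.
  by move=> B /sP [x Ax ->]; rewrite -psiP mulmxA mulmxE sPi.
have trPi : \tr Pi = d%:R.
  rewrite /Pi mxtraceZ (bigD1 (0 : W) A0) /= linearD /= s0 mxtrace1 linear_sum /= big1 ?addr0.
    by rewrite hdimE -dA natrM mulrC mulfK.
  by move=> x /andP[_ x0]; rewrite mxtraceZ wop_tr// mulr0.
suff -> : d = \rank Pi by rewrite codeE; exact: projector_has_dim.
by apply/eqP; rewrite -(eqr_nat R[i]) -trPi projector_mxtrace.
Qed.

End Dimension.

(** * Colored edges and faces of the lattice *)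

Definition next_color (l : color) : color :=
  match l with Green => Red | Red => Blue | Blue => Green end.

Local Notation rot := Defs.rot.

Lemma color_cases (a b l l' : color) :
  l != l' -> a != l' -> b != l' -> a != b -> l = a \/ l = b.
Proof. by case: a; case: b; case: l; case: l' => //; intuition. Qed.

Section Rotation.
Variables (p g : nat) (L : colored_lattice p g).
Local Notation V := (vertex L).
Implicit Types (v u w x y : V) (l : color).

Lemma adjC x y : adj x y = adj y x. Proof. exact: adj_sym. Qed.

Lemma adj_rot x y : adj x y -> adj x (rot x y).
Proof. by move=> xy; rewrite -(rot_cyclic _ xy) fconnect1. Qed.

Lemma orbit_rot x y : adj x y -> orbit (rot x) y = [:: y; rot x y; rot x (rot x y)].
Proof.
move=> xy; rewrite /orbit [order _ _](_ : _ = 3%N)//.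
rewrite -(lattice_degree x); apply: eq_card => u.
by rewrite inE -(rot_cyclic _ xy) !inE.
Qed.

Lemma rot_uniq x y : adj x y -> uniq [:: y; rot x y; rot x (rot x y)].
Proof. by move=> xy; rewrite -orbit_rot// orbit_uniq. Qed.

Lemma adj_rotE x y z : adj x y -> adj x z = (z \in [:: y; rot x y; rot x (rot x y)]).
Proof. by move=> xy; rewrite -orbit_rot// -fconnect_orbit (rot_cyclic _ xy). Qed.

Lemma rot3 x y : adj x y -> rot x (rot x (rot x y)) = y.
Proof.
move=> xy; have := adj_rot (adj_rot (adj_rot xy)); rewrite (adj_rotE _ xy).
have := rot_uniq (adj_rot xy); rewrite /= !inE.
set z := rot x (rot x (rot x y)); rewrite negb_or => /and3P[/andP[_ n1] n2 _].
by move=> /or3P[/eqP|/eqP zE|/eqP zE]//; rewrite zE eqxx in n1 n2.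
Qed.

Definition dart : {set V * V} := [set d | adj d.1 d.2].

Lemma dart_step : {homo @face_step L : d / d \in dart}.
Proof. by move=> [x y]; rewrite !inE /= adjC; exact: adj_rot. Qed.

Lemma face_step_inj : {in dart &, injective (@face_step L)}.
Proof.
move=> [x y] [x' y']; rewrite !inE /= => xy xy'; rewrite /face_step /= => -[yy' rE].
rewrite -yy' adjC in xy'; rewrite adjC in xy.
by rewrite -(rot3 xy) rE -yy' (rot3 xy') yy'.
Qed.

(** Faces partition the darts: reachability under [face_step] is symmetric there, since the map is
    injective on darts and preserves them. *)
Lemma mem_face d d' : d \in dart -> d' \in face d -> d' \in dart /\ face d' = face d.
Proof.
move=> dd; rewrite inE => dd'.
have d'd : d' \in dart.
  rewrite -(iter_findex dd'); elim: (findex _ _ _) => [|k IH] //=.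
  exact: dart_step.
split=> //; apply/setP => d2; rewrite !inE.
apply/idP/idP => [|dd2]; first exact: connect_trans.
by rewrite (fconnect_sym_in dart_step face_step_inj) in dd'; [exact: connect_trans dd' dd2|..].
Qed.

Lemma face_rot x y : adj x y -> face (x, rot x y) = face (y, x).
Proof.
move=> xy; apply: (mem_face _ _).2; first by rewrite inE adjC.
by rewrite inE; exact: fconnect1.
Qed.

Definition kappa x y : color := face_color (face (x, y)).

Lemma kappa_rot x y : adj x y -> kappa x (rot x y) = kappa y x.
Proof. by move=> xy; rewrite /kappa face_rot. Qed.

Lemma kappa_neq x y : adj x y -> kappa x y != kappa y x.
Proof. exact: face_color_proper. Qed.

(** Faces consecutive around [x] share an edge, and among three faces in cyclic order any two are
    consecutive. *)
Lemma kappa_uniq x y : adj x y ->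
  uniq [:: kappa x y; kappa x (rot x y); kappa x (rot x (rot x y))].
Proof.
have next z : adj x z -> kappa x z != kappa x (rot x z).
  by move=> xz; rewrite kappa_rot// kappa_neq.
move=> xy; have xy1 := adj_rot xy; have xy2 := adj_rot xy1.
rewrite /= !inE negb_or !next//= andbT eq_sym.
by rewrite -{2}(rot3 xy) next.
Qed.

Lemma color3 (a b c l : color) : uniq [:: a; b; c] -> l \in [:: a; b; c].
Proof. by case: a; case: b; case: c; case: l. Qed.

Lemma neighbor x : exists y, adj x y.
Proof.
have /card_gt0P [y] : (0 < #|[set u | adj x u]%SET|)%N by rewrite lattice_degree.
by rewrite inE; exists y.
Qed.

Lemma corner_ex x l : exists y, adj x y && (kappa x y == l).
Proof.
have [y xy] := neighbor x.
have := color3 l (kappa_uniq xy); rewrite !inE.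
have xy1 := adj_rot xy; have xy2 := adj_rot xy1.
by move=> /or3P[]/eqP ->; [exists y|exists (rot x y)|exists (rot x (rot x y))];
   rewrite eqxx andbT.
Qed.

Definition corner x l : V := xchoose (corner_ex x l).

Lemma cornerP x l : adj x (corner x l) /\ kappa x (corner x l) = l.
Proof. by have /andP[? /eqP] := xchooseP (corner_ex x l). Qed.

Lemma kappa_inj x y z : adj x y -> adj x z -> kappa x y = kappa x z -> y = z.
Proof.
move=> xy; rewrite (adj_rotE _ xy) !inE => /or3P[]/eqP -> // kE;
by move: (kappa_uniq xy); rewrite -kE /= !inE eqxx ?orbT.
Qed.

Lemma cornerE x y : adj x y -> corner x (kappa x y) = y.
Proof. by move=> xy; have [? ?] := cornerP x (kappa x y); apply: (@kappa_inj x). Qed.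

(* The neighbour of x along its color-l edge, which is opposite to the color-l
   corner at x. *)
Definition tau l x : V := rot x (corner x l).

(** Of the three edges at [x], only the one opposite to the color-l face has no side of color [l].
    The description is symmetric in the two ends, whence [tauK]. *)
Lemma tauP l x y : y = tau l x <-> [/\ adj x y, kappa x y != l & kappa y x != l].
Proof.
have [xc kc] := cornerP x l; have u := kappa_uniq xc.
split=> [->|[xy k1 k2]].
  have xt := adj_rot xc; split=> //.
    by rewrite -{2}kc kappa_rot// eq_sym kappa_neq.
  rewrite -(kappa_rot xt) -{2}kc.
  by move: u; rewrite /= !inE !negb_or => /and3P[/andP[_]]; rewrite eq_sym.
have := color3 l (kappa_uniq xy); rewrite !inE [l == kappa x y]eq_sym (negPf k1) /=.
rewrite kappa_rot// eq_sym (negPf k2) /= => /eqP lE.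
by rewrite /tau lE cornerE ?rot3 ?adj_rot// adj_rot.
Qed.

Lemma adj_tau l x : adj x (tau l x).
Proof. by have [/(_ erefl)[]] := tauP l x (tau l x). Qed.

Lemma tauK l : involutive (tau l).
Proof.
move=> x; apply/esym/tauP; have [/(_ erefl)[xt k1 k2] _] := tauP l x (tau l x).
by rewrite adjC.
Qed.

Lemma tau_neq l x : tau l x != x.
Proof.
apply/eqP => tx; have := adj_tau l x; rewrite tx.
by rewrite adj_irrefl.
Qed.

Lemma adj_tauE x y : adj x y -> exists l, y = tau l x.
Proof.
move=> xy; exists (kappa x (rot x (rot x y))); apply/tauP; split=> //.
  by move: (kappa_uniq xy); rewrite /= !inE !negb_or => /and3P[/andP[]].
by move: (kappa_uniq xy); rewrite /= !inE kappa_rot// => /and3P[].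
Qed.

Lemma edge_colorP l x y : edge_color l x y <-> y = tau l x.
Proof.
rewrite tauP; split=> [[xy H]|[xy k1 k2]].
  have xy1 := adj_rot xy; have xy2 := adj_rot xy1.
  (* This corner belongs to the face at [x] off the edge: if that face contained a dart of the edge
     it would be one of the two sides, against [kappa_uniq]. *)
  have kl : kappa x (rot x (rot x y)) = l.
    apply: H => //; first by rewrite eqxx.
    move: (kappa_uniq xy); rewrite /= !inE !negb_or => /and3P[/andP[_ n1] n2 _].
    apply/andP; split; apply/negP => /mem_face; rewrite inE => /(_ xy2)[_ fE].
      by move: n1; rewrite /kappa fE eqxx.
    by move: n2; rewrite kappa_rot// /kappa fE eqxx.
  move: (kappa_uniq xy); rewrite /= !inE !negb_or kl kappa_rot//.
  by move=> /and3P[/andP[_ ->] -> _].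
have main x' y' : adj x' y' -> kappa x' y' != l -> kappa y' x' != l ->
    forall z, adj x' z -> ~~ in_boundary x' y' (face (x', z)) -> kappa x' z = l.
  move=> xy' k1' k2' z; rewrite (adj_rotE _ xy') !inE => /or3P[]/eqP ->.
  - by rewrite /in_boundary [_ \in _]inE connect0.
  - by rewrite face_rot// /in_boundary orbC [_ \in _]inE connect0.
  - move=> _; have := color3 l (kappa_uniq xy'); rewrite !inE.
    rewrite [l == kappa x' y']eq_sym (negPf k1') kappa_rot// [l == kappa y' x']eq_sym.
    by rewrite (negPf k2') => /eqP.
split=> // x' z /orP[]/eqP -> xz nb; first exact: (main x y).
by apply: (main y x) => //; [rewrite adjC | move: nb; rewrite /in_boundary orbC].
Qed.

Definition fc l x : {set V * V} := face (x, corner x l).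

Lemma fc_kappa x y : adj x y -> fc (kappa x y) x = face (x, y).
Proof. by move=> xy; rewrite /fc cornerE. Qed.

(** The two sides of a color-l' edge have the two other colors, and both ends of the edge lie on
    both sides. *)
Lemma fc_tau l l' x : l != l' -> fc l (tau l' x) = fc l x.
Proof.
have [/(_ erefl)] := tauP l' x (tau l' x); set y := tau l' x => -[xy k1 k2] _ ll'.
have := kappa_neq xy => k12.
have yx : adj y x by rewrite adjC.
have [lE|lE] : l = kappa x y \/ l = kappa y x.
  exact: color_cases ll' k1 k2 k12.
  rewrite {2}lE fc_kappa// -(face_rot yx) -fc_kappa ?adj_rot//.
  by rewrite kappa_rot// -lE.
rewrite {1}lE fc_kappa// -(face_rot xy) -fc_kappa ?(adj_rot xy)//.
by rewrite kappa_rot// -lE.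
Qed.

(** The boundary walk of a color-l face only follows edges of the other two colors, so [f] never
    changes along it. *)
Lemma fc_invariant (T : Type) (f : V -> T) l :
  (forall l' x, l != l' -> f (tau l' x) = f x) ->
  forall x y, fc l x = fc l y -> f x = f y.
Proof.
move=> fl x y fxy.
have [xc kc] := cornerP x l; have [yc kc'] := cornerP y l.
have : (y, corner y l) \in fc l x by rewrite fxy inE connect0.
rewrite inE => /iter_findex; set n := findex _ _ _ => itn.
have H k : let d := iter k (@face_step L) (x, corner x l) in
    [/\ adj d.1 d.2, kappa d.1 d.2 = l & f d.1 = f x].
  elim: k => [|k] //=; case: (iter k _ _) => a b /= [ab kab fab].
  have ba : adj b a by rewrite adjC.
  split; [exact: adj_rot | by rewrite kappa_rot |].
  have [l' bE] := adj_tauE ab; rewrite bE fl//.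
  by have [/(_ bE) [_ + _] _] := tauP l' a b; rewrite kab.
by have /= := H n; rewrite itn => -[_ _ ->].
Qed.

Lemma fc_color l x : face_color (fc l x) = l.
Proof. by have [_] := cornerP x l. Qed.

Lemma tau_connected (T : Type) (f : V -> T) :
  (forall l x, f (tau l x) = f x) -> forall x y, f x = f y.
Proof.
move=> fl x y; have /connectP [q] := adj_connected x y.
elim: q x => [|z q IH] x /=; first by move=> _ ->.
move=> /andP[/adj_tauE[l zE] pq] yE; rewrite -(IH z) //.
by rewrite zE fl.
Qed.

(** The empty graph has Euler characteristic 0, which is that of genus 1. *)
Lemma vertices_gt0 : g != 1%N -> (0 < #|V|)%N.
Proof.
move=> g1; rewrite lt0n; apply: contra g1 => /eqP V0.
have noV (v : V) : False by have := card0_eq V0 v; rewrite inE.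
have E0 : edges L = finset.set0.
  by apply/setP => e; rewrite inE; apply/negP => /imsetP [[x y] _ _]; exact: (noV x).
have F0 : faces L = finset.set0.
  by apply/setP => e; rewrite inE; apply/negP => /imsetP [[x y] _ _]; exact: (noV x).
have := lattice_genus L; rewrite V0 E0 F0 !cards0; lia.
Qed.

End Rotation.

(** * Counting edges, faces and invariant functions *)

Lemma card_invariant (V T : finType) (K : finType) (k0 : K) (q : V -> T)
    (A : {set {ffun V -> K}}) :
  (forall f : {ffun V -> K}, f \in A <-> (forall x y, q x = q y -> f x = f y)) ->
  #|A| = (#|K| ^ #|[set q x | x in V]%SET|)%N.
Proof.
move=> AP; set Q := [set q x | x in V]%SET.
pose lift (h : {ffun T -> K}) : {ffun V -> K} := [ffun x => h (q x)].
have -> : A = [set lift h | h in pffun_on k0 (mem Q) (mem K)]%SET.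
  apply/setP => f; apply/idP/imsetP => [/AP fA|[h _ ->]]; last first.
    by apply/AP => x y qxy; rewrite !ffunE qxy.
  (* The factorization of [f] through [q] takes the value [k0] off the image of [q], which makes it
     unique. *)
  exists [ffun t => if [pick x | q x == t] is Some x then f x else k0].
    apply/pffun_onP; split=> // ; apply/supportP => t tQ; rewrite ffunE.
    case: pickP => // x /eqP qx; case/negP: tQ; apply/imsetP; by exists x.
  apply/ffunP => x; rewrite !ffunE; case: pickP => [y /eqP/fA ->//|/(_ x)].
  by rewrite eqxx.
rewrite card_in_imset ?card_pffun_on// => h1 h2 /pffun_onP[/supportP s1 _] /pffun_onP[/supportP s2 _] h12.
apply/ffunP => t; have [/imsetP [x _ ->]|tQ] := boolP (t \in Q).
  by move/ffunP: h12 => /(_ x); rewrite !ffunE.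
by rewrite s1 ?s2.
Qed.

Section Counting.
Variables (p g : nat) (L : colored_lattice p g).
Local Notation V := (vertex L).
Implicit Types (x y : V) (l : color).

Definition edge_of l x : {set V} := [set x; tau l x]%SET.

Lemma edge_ofE l x y : edge_of l x = edge_of l y <-> y = x \/ y = tau l x.
Proof.
split=> [exy|[->|->]] //; last by rewrite /edge_of tauK finset.setUC.
have : y \in edge_of l x by rewrite exy !inE eqxx.
by rewrite !inE => /orP[]/eqP ->; [left|right].
Qed.

Lemma card_edges l : (2 * #|[set edge_of l x | x in V]%SET| = #|V|)%N.
Proof.
rewrite mulnC -[RHS]sum1_card (partition_big_imset (edge_of l))/=.
rewrite -sum_nat_const; apply: eq_bigr => e /imsetP [x _ ->].
rewrite sum1dep_card -[LHS](_ : #|[set x; tau l x]%SET| = 2%N).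
  apply: eq_card => y; rewrite !inE; apply/idP/idP.
    by move=> yx; rewrite eq_sym; apply/eqP/edge_ofE; case/orP: yx => /eqP; auto.
  by rewrite eq_sym => /eqP/edge_ofE[]->; rewrite eqxx ?orbT.
by rewrite cards2 eq_sym tau_neq.
Qed.

Lemma card_dart : #|dart L| = (3 * #|V|)%N.
Proof.
rewrite -sum1_card; under eq_bigl => d do rewrite inE.
rewrite -(pair_big_dep predT (fun x y => adj x y) (fun _ _ => 1%N))/=.
rewrite mulnC -sum_nat_const; apply: eq_bigr => x _.
by rewrite sum1dep_card lattice_degree.
Qed.

Lemma facesE : faces L = [set face d | d in dart L]%SET.
Proof.
by apply/setP => f; apply/imsetP/imsetP => -[d dd ->]; exists d; rewrite // inE in dd *.
Qed.

(** Double counting of darts: three leave each vertex, and the faces partition them into classes of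
    size p. *)
Lemma card_faces_size : (p * #|faces L| = 3 * #|V|)%N.
Proof.
rewrite -card_dart -[RHS]sum1_card (partition_big_imset (@face L))/= -facesE.
rewrite mulnC -sum_nat_const; apply: eq_bigr => f fF.
rewrite sum1dep_card -[LHS](lattice_face_size fF); apply: eq_card => d.
move: fF; rewrite facesE inE => /imsetP [d0 d0d ->].
apply/idP/andP => [/(mem_face d0d)[-> ->] //|[dd /eqP <-]].
by rewrite inE connect0.
Qed.

Definition faces_of l := [set fc l x | x in V]%SET.

Lemma card_faces : #|faces L| = (#|faces_of Green| + #|faces_of Red| + #|faces_of Blue|)%N.
Proof.
have fE l : faces_of l = [set f in faces L | face_color f == l].
  apply/setP => f; rewrite inE facesE; apply/imsetP/andP => [[x _ ->]|[/imsetP [[x y]]]].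
    rewrite fc_color; split=> //; apply/imsetP; exists (x, corner x l) => //.
    by rewrite inE; have [] := cornerP x l.
  by rewrite inE /= => xy -> /eqP <-; exists x => //; rewrite fc_kappa.
have cE (A : {set {set V * V}}) : #|A| = (\sum_f (f \in A : nat))%N.
  by rewrite -sum1_card big_mkcond; apply: eq_bigr => f _; case: (f \in A).
rewrite !fE !cE -!big_split /=; apply: eq_bigr => f _.
by rewrite !inE; case: (f \in faces L) => //=; case: (face_color f).
Qed.

Lemma next_color_cases l l' : l != l' -> l' = next_color l \/ l' = next_color (next_color l).
Proof. by case: l; case: l' => //; auto. Qed.

Lemma card_faces_next l : #|faces L| =
  (#|faces_of l| + #|faces_of (next_color l)| + #|faces_of (next_color (next_color l))|)%N.
Proof. by rewrite card_faces; case: l => /=; lia. Qed.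

Variable K : finType.

Definition edge_inv l (f : {ffun V -> K}) := [forall x, f (tau l x) == f x].
(** By [fc_tau] and [fc_invariant] this means constant around every color-l face. In this form,
    invariance along edges of two colors at once is literally a plaquette condition. *)
Definition face_inv l f := edge_inv (next_color l) f && edge_inv (next_color (next_color l)) f.

Lemma edge_invP l (f : {ffun V -> K}) : reflect (forall x, f (tau l x) = f x) (edge_inv l f).
Proof. exact: 'forall_eqP. Qed.

Lemma face_invP l (f : {ffun V -> K}) :
  reflect (forall l' x, l != l' -> f (tau l' x) = f x) (face_inv l f).
Proof.
apply: (iffP andP) => [[/edge_invP f1 /edge_invP f2] l' x /next_color_cases[]->//|H].
by split; apply/edge_invP => x; apply: H; case: l.
Qed.

Lemma card_edge_inv (k0 : K) l :
  #|[set f | edge_inv l f]%SET| = (#|K| ^ #|[set edge_of l x | x in V]%SET|)%N.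
Proof.
apply: card_invariant => // f; rewrite inE; split=> [/edge_invP fl x y /edge_ofE[]-> //|H].
by apply/edge_invP => x; apply/esym/H/edge_ofE; right.
Qed.

Lemma card_face_inv (k0 : K) l : #|[set f | face_inv l f]%SET| = (#|K| ^ #|faces_of l|)%N.
Proof.
apply: card_invariant => // f; rewrite inE; split=> [/face_invP fl|H].
  exact: fc_invariant.
by apply/face_invP => l' x ll'; apply: H; exact: fc_tau.
Qed.
End Counting.

(** * Measuring a commuting family of checks *)

Section Measurement.
Variables (R : realType) (D : nat) (V : finType).
Hypothesis D_prime : prime D.
Local Notation F := 'F_D.
Local Notation G := {ffun V -> F}.
Local Notation W := (G * G)%type.
Local Notation wop := (@wop R D V).
Implicit Types (ys : seq W) (e x y z : W).

Fixpoint spanned ys e : Prop :=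
  if ys is y :: ys' then exists k e', spanned ys' e' /\ e = e' + y *+ k else e = 0.

Lemma spanned0 ys : spanned ys 0.
Proof.
elim: ys => [|y ys IH] //=; exists 0%N, 0; split=> //.
by rewrite mulr0n addr0.
Qed.

Lemma spannedD ys e e' : spanned ys e -> spanned ys e' -> spanned ys (e + e').
Proof.
elim: ys e e' => [|y ys IH] e e' /=; first by move=> -> ->; rewrite addr0.
move=> [k [e1 [s1 ->]]] [k' [e2 [s2 ->]]]; exists (k + k')%N, (e1 + e2).
by split; [exact: IH | rewrite mulrnDr addrACA].
Qed.

Lemma spanned_mem ys y k : y \in ys -> spanned ys (y *+ k).
Proof.
elim: ys => [|y' ys IH] //=; rewrite inE => /orP[/eqP ->|/IH sy].
  by exists k, 0; split; [exact: spanned0 | rewrite add0r].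
by exists 0%N, (y *+ k); rewrite mulr0n addr0.
Qed.

Definition after_measuring ys (L : W -> Prop) z : Prop :=
  exists x e, [/\ L x, forall y, y \in ys -> sp x y = 0, spanned ys e & z = x + e].

Definition commuting_checks ys :=
  (forall y, y \in ys -> wop y ^+ D = 1) /\
  (forall y y', y \in ys -> y' \in ys -> sp y y' = 0).

Lemma commuting_checks_cons y ys : commuting_checks (y :: ys) -> commuting_checks ys.
Proof.
case=> H1 H2; split=> [x xy|x x' xy xy']; first by apply: H1; rewrite inE xy orbT.
by apply: H2; rewrite inE ?xy ?xy' orbT.
Qed.

(** As the checks commute with each other, the multiples of [y] added first pass all later
    commutation tests, so the successive updates collapse to one simultaneous condition. *)
Lemma stab_measured ys S S' L : commuting_checks ys -> stab S L ->
  measured (map wop ys) S S' -> stab S' (after_measuring ys L).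
Proof.
elim: ys S L => [|y ys IH] S L ysP SL /=.
  move=> ->; apply: stab_ext SL => x; split=> [Lx|[x' [e [Lx _ -> ->]]]]; last by rewrite addr0.
  by exists x, 0; split=> //; rewrite addr0.
move=> [a [po ms]]; have yD : wop y ^+ D = 1 by apply: ysP.1; rewrite mem_head.
have SL1 := stab_update D_prime SL yD po.
apply: stab_ext (IH _ _ (commuting_checks_cons ysP) SL1 ms) => z; split.
  move=> [x1 [e [[x [k [Lx xy ->]]] x1y se ->]]].
  exists x, (e + y *+ k); split=> //; last by rewrite [e + _]addrC addrA.
    move=> y'; rewrite inE => /orP[/eqP -> //|y'ys].
    have := x1y _ y'ys; rewrite spDl spMnl (ysP.2 y y') ?mem_head ?inE ?y'ys ?orbT//.
    by rewrite mul0rn addr0.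
  by exists k, e.
move=> [x [e [Lx xy [k [e' [se ->]]] ->]]]; exists (x + y *+ k), e'; split=> //.
- by exists x, k; split=> //; apply: xy; rewrite mem_head.
- move=> y' y'ys; rewrite spDl spMnl xy ?inE ?y'ys ?orbT//.
  by rewrite (ysP.2 y y') ?mem_head ?inE ?y'ys ?orbT// mul0rn addr0.
- by rewrite [e' + _]addrC addrA.
Qed.

Lemma measured_ex ys S L : commuting_checks ys -> stab S L ->
  exists S', measured (map wop ys) S S'.
Proof.
elim: ys S L => [|y ys IH] S L ysP SL /=; first by exists S.
have yD : wop y ^+ D = 1 by apply: ysP.1; rewrite mem_head.
have [a po] := possible_outcome_ex D_prime SL yD.
have [S' mS'] := IH _ _ (commuting_checks_cons ysP) (stab_update D_prime SL yD po).
by exists S', a.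
Qed.

End Measurement.

(** In [check_plaq_step] this trades the old checks [a] for the negatives of [a1], absorbed by the
    new checks, and of [a2], absorbed by the plaquettes. *)
Lemma zmod_shift (U : zmodType) (a a1 a2 b g0 g1 g2 : U) :
  a + a1 + a2 = 0 -> a + (g0 + g1 + g2) + b = (b - a1) + (g0 + g1 + (g2 - a2)).
Proof.
move/eqP; rewrite -addrA addr_eq0 => /eqP ->.
by rewrite opprD (AC (2*3*1) ((6*1)*(3*4*(5*2)))).
Qed.

(** * Commutation of checks and plaquettes; one round of measurement *)

Section Checks.
Variables (R : realType) (D : nat).
Hypothesis D_prime : prime D.
Variables (p g : nat) (C : floquet_code R D p g).
Local Notation F := 'F_D.
Local Notation V := (vertex C).
Local Notation G := {ffun V -> F}.
Local Notation W := (G * G)%type.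
Local Notation wop := (@wop R D V).
Implicit Types (u v : V) (l : color) (f : G).

Definition ev v l : F * F := ((exps v l).1%:R, (exps v l).2%:R).

Definition chk l v : W := exp_site v (exps v l) + exp_site (tau l v) (exps (tau l v) l).

Lemma checksP l P : checks C l P <-> exists v, P = wop (chk l v).
Proof.
split=> [[v [u [/edge_colorP uE ->]]]|[v ->]]; exists v.
  by rewrite on_site_pauliM// uE// eq_sym tau_neq.
exists (tau l v); split; first exact/edge_colorP.
by rewrite on_site_pauliM// eq_sym tau_neq.
Qed.

(** For odd D the prime D divides the binomial in [wop_exp], so the phase disappears; D = 2 is
    covered by [check_order]. *)
Lemma wop_chk_order l v : wop (chk l v) ^+ D = 1.
Proof.
have [D2|D2] := eqVneq D 2%N.
  by apply: (check_order D2 (l := l)); apply/checksP; exists v.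
rewrite wop_exp// WmulnD// wop0//.
have /dvdnP [k ->] : (D %| 'C(D, 2))%N.
  by apply: prime_dvd_bin => //=; rewrite ltn_neqAle eq_sym D2 prime_gt1.
by rewrite mulnC mulrnA -[_ *+ D]mulr_natr pchar_Fp_0// mulr0 mul0rn phase0// scale1r.
Qed.

Lemma commE v l l' :
  comm (exps v l) (exps v l') = (ev v l).2 * (ev v l').1 - (ev v l).1 * (ev v l').2.
Proof. by rewrite /comm addrC. Qed.

Lemma ev_sum v : ev v Green + ev v Red + ev v Blue = 0.
Proof.
pose u := tau Green v; have vu : adj v u := adj_tau _ _.
have uv : u != v := tau_neq _ _.
pose s w := ev w Green + ev w Red + ev w Blue.
have Q w : exists2 c : R[i], c != 0 &
    pauli R (exps w Green) * pauli R (exps w Red) * pauli R (exps w Blue) = c *: weyl1 R (s w).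
  rewrite !pauliE// weyl1M// sqmxZl weyl1M// scalerA; eexists; last reflexivity.
  by rewrite mulf_neq0 ?phase_neq0.
have /= := prod_site vu; have [c c0 ->] := Q v; have [c' c'0 ->] := Q u.
rewrite !on_siteZ !on_site_weyl1// sqmxZl sqmxZr wopM// !scalerA => H.
(* Condition (iii) makes a nonzero multiple of one Weyl operator the identity, so its label
   vanishes; as [u] differs from [v], this can be read off at [v] alone. *)
have {}H : site v (s v) + site u (s u) = 0.
  apply: (wop_scalar D_prime (b := 1) _ (etrans H _)); last by rewrite scale1r.
  by rewrite !mulf_neq0 ?phase_neq0.
apply: injective_projections.
  have /(congr1 (fun x : W => x.1 v)) := H.
  by rewrite /= !ffunE eqxx eq_sym (negPf uv) mulr1n mulr0n addr0.
have /(congr1 (fun x : W => x.2 v)) := H.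
by rewrite /= !ffunE eqxx eq_sym (negPf uv) mulr1n mulr0n addr0.
Qed.

Lemma ev_sum_next v l : ev v l + ev v (next_color l) + ev v (next_color (next_color l)) = 0.
Proof.
case: l => /=; first exact: ev_sum.
- by have := ev_sum v; rewrite -addrA addrC.
- by have := ev_sum v; rewrite addrC addrA.
Qed.

Definition cv v : F := comm (exps v Green) (exps v Red).

Lemma cv_neq0 v : cv v != 0.
Proof. by have [] := comm_neq0 v. Qed.

Lemma comm_next v l : comm (exps v l) (exps v (next_color l)) = cv v.
Proof.
have := ev_sum v; case: l; rewrite /next_color /cv !commE; case: (ev v Green) => a b;
  case: (ev v Red) => a' b'; case: (ev v Blue) => a'' b'' /=;
  move=> H; have /= h1 := congr1 fst H; have /= h2 := congr1 snd H;
  have a3 : a'' = - (a + a') by [apply: (addrI (a + a')); rewrite subrr];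
  have b3 : b'' = - (b + b') by [apply: (addrI (b + b')); rewrite subrr];
  by rewrite ?a3 ?b3; ring.
Qed.

Lemma comm_antisym v l l' : comm (exps v l) (exps v l') = - comm (exps v l') (exps v l).
Proof. by rewrite !commE; ring. Qed.

Lemma cv_tau l v : cv (tau l v) = - cv v.
Proof.
have evu : edge_color l v (tau l v) by apply/edge_colorP.
case: l evu => evu.
- have := comm_green evu.
  rewrite !(comm_antisym _ Green) (comm_next _ Blue) (comm_next _ Blue).
  by move/oppr_inj => ->; rewrite opprK.
- have := comm_red evu.
  rewrite !(comm_antisym _ Red) (comm_next _ Green) (comm_next _ Green).
  by move/oppr_inj => ->; rewrite opprK.
- have := comm_blue evu.
  rewrite !(comm_antisym _ Blue) (comm_next _ Red) (comm_next _ Red).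
  by move/oppr_inj => ->; rewrite opprK.
Qed.

(** Label of the product over all v of the color-l Pauli at v raised to [f v]. Those with
    [edge_inv l f] are the products of checks, by [spanned_chks]. *)
Definition cmb f l : W := ([ffun v => f v * (ev v l).1], [ffun v => f v * (ev v l).2]).

Lemma cmbD f f' l : cmb (f + f') l = cmb f l + cmb f' l.
Proof. by apply: injective_projections; apply/ffunP => v; rewrite !ffunE mulrDl. Qed.

Lemma cmb0 l : cmb 0 l = 0.
Proof. by apply: injective_projections; apply/ffunP => v; rewrite !ffunE mul0r. Qed.

Lemma cmbN f l : cmb (- f) l = - cmb f l.
Proof. by apply: injective_projections; apply/ffunP => v; rewrite !ffunE mulNr. Qed.

Lemma cmb_sum f l : cmb f l + cmb f (next_color l) + cmb f (next_color (next_color l)) = 0.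
Proof.
apply: injective_projections; apply/ffunP => v; rewrite !ffunE -!mulrDr.
  by have /(congr1 fst) /= -> := ev_sum_next v l; rewrite mulr0.
by have /(congr1 snd) /= -> := ev_sum_next v l; rewrite mulr0.
Qed.

Lemma sp_site (x : W) v (ab : F * F) : sp x (site v ab) = x.2 v * ab.1 - ab.2 * x.1 v.
Proof. by rewrite /sp dot_site1 dot_site2. Qed.

Lemma sp_cmb_chk f l l' v : sp (cmb f l) (chk l' v) =
  f v * comm (exps v l) (exps v l') + f (tau l' v) * comm (exps (tau l' v) l) (exps (tau l' v) l').
Proof. by rewrite spDr !sp_site !commE /= !ffunE; ring. Qed.

(** The sign change of [cv] along edges turns the sum of the two end contributions into a
    difference; as [cv v] is nonzero, commutation means equal coefficients at both ends. *)
Lemma sp_cmb_chk_next f l v :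
  sp (cmb f l) (chk (next_color l) v) = (f v - f (tau (next_color l) v)) * cv v.
Proof. by rewrite sp_cmb_chk !comm_next cv_tau; ring. Qed.

Lemma next_color3 l : next_color (next_color (next_color l)) = l.
Proof. by case: l. Qed.

Lemma comm_tau l l' m v :
  comm (exps (tau m v) l) (exps (tau m v) l') = - comm (exps v l) (exps v l').
Proof.
have [<-|ll'] := eqVneq l l'; first by rewrite !commE; ring.
have [->|->] := next_color_cases ll'; first by rewrite !comm_next cv_tau.
by rewrite !(comm_antisym _ l) -{2 4}[l]next_color3 !comm_next cv_tau.
Qed.

Lemma sp_cmb_chk0 f l l' v :
  (l != l' -> f (tau l' v) = f v) -> sp (cmb f l) (chk l' v) = 0.
Proof.
have [<- _|ll' /(_ isT) fE] := eqVneq l l'; first by rewrite sp_cmb_chk !commE; ring.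
by rewrite sp_cmb_chk fE comm_tau; ring.
Qed.

Lemma eq_tau l u v : (u == tau l v) = (v == tau l u).
Proof. by rewrite eq_sym (can2_eq (tauK l) (tauK l)). Qed.

Definition edge_ind l v : G := [ffun u => (u == v)%:R + (u == tau l v)%:R].

Lemma chk_cmb l v : chk l v = cmb (edge_ind l v) l.
Proof.
apply: injective_projections; apply/ffunP => u; rewrite !ffunE /=;
have [->|uv] := eqVneq u v; rewrite ?[v == _]eq_sym ?(negPf (tau_neq _ _)) ?(negPf uv);
rewrite ?(eqxx, mulr0n, mulr1n, mul1r, addr0, add0r) //;
by have [->|_] := eqVneq u (tau l v); rewrite ?(mulr0n, mulr1n, mul1r, mul0r).
Qed.

Lemma sp_chk l v v' : sp (chk l v) (chk l v') = 0.
Proof. by rewrite chk_cmb; apply: sp_cmb_chk0; rewrite eqxx. Qed.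

Definition chks l : seq W := undup [seq chk l v | v <- enum V].

Lemma mem_chks l y : reflect (exists v, y = chk l v) (y \in chks l).
Proof.
rewrite mem_undup; apply: (iffP mapP) => [[v _ ->]|[v ->]]; exists v => //.
by rewrite mem_enum.
Qed.

Lemma commuting_chks l ys : {subset ys <= chks l} -> commuting_checks R ys.
Proof.
move=> yl; split=> [y /yl/mem_chks[v ->]|y y' /yl/mem_chks[v ->] /yl/mem_chks[v' ->]].
  exact: wop_chk_order.
exact: sp_chk.
Qed.

Lemma ffun_mulrn f k v : (f *+ k) v = f v *+ k.
Proof. by elim: k => [|k IH]; rewrite ?ffunE// !mulrS ffunE IH. Qed.

Lemma cmbMn f l k : cmb (f *+ k) l = cmb f l *+ k.
Proof. by elim: k => [|k IH]; rewrite ?cmb0// !mulrS cmbD IH. Qed.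

(* One term is kept for each edge {v, tau l v}: halving a sum over all vertices
   would fail for D = 2. *)
Lemma cmb_sum_chk f l : edge_inv l f ->
  cmb f l = \sum_(v | (enum_rank v < enum_rank (tau l v))%N) chk l v *+ f v.
Proof.
move=> /edge_invP fl; set rep := fun v => (enum_rank v < enum_rank (tau l v))%N.
under eq_bigr do rewrite chk_cmb -cmbMn.
rewrite -(big_morph (fun h => cmb h l) (fun a b => cmbD a b l) (cmb0 l)).
congr cmb; apply/ffunP => u; rewrite sum_ffunE.
under eq_bigr => v _ do rewrite ffun_mulrn ffunE -[(_ + _) *+ _]mulr_natr natr_Zp mulrDl.
rewrite big_split /=.
have sumE w : \sum_(v | rep v) (v == w)%:R * f v = f w *+ rep w.
  rewrite big_mkcond (bigD1 w) //= eqxx mul1r big1 ?addr0; first by case: (rep w).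
  by move=> v /negPf ->; rewrite mul0r; case: ifP.
under eq_bigr do rewrite eq_sym.
under [X in _ + X]eq_bigr do rewrite eq_tau.
rewrite !sumE fl /rep tauK.
(* Exactly one of [u] and [tau l u] represents its edge, so [f u] is counted once. *)
have : enum_rank u != enum_rank (tau l u) by rewrite (inj_eq enum_rank_inj) eq_sym tau_neq.
by rewrite -val_eqE /=; case: ltngtP => // _ _; rewrite ?addr0 ?add0r.
Qed.

Lemma spanned_chks l (e : W) : spanned (chks l) e <-> exists2 f, edge_inv l f & e = cmb f l.
Proof.
split=> [|[f fl ->]]; last first.
  rewrite cmb_sum_chk//; apply: big_rec; first exact: spanned0.
  move=> v x _ sx; apply: spannedD => //; apply: spanned_mem.
  by apply/mem_chks; exists v.
have : {subset chks l <= chks l} by [].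
move: {1 3}(chks l) => ys; elim: ys e => [|y ys IH] e /= ysl.
  by move=> ->; exists 0; rewrite ?cmb0//; apply/edge_invP => x; rewrite !ffunE.
move=> [k [e' [se ->]]].
have [z zy|f fl ->] := IH e' _ se; first by apply: ysl; rewrite inE zy orbT.
have /mem_chks [v ->] : y \in chks l by apply: ysl; rewrite mem_head.
exists (f + edge_ind l v *+ k); last by rewrite cmbD cmbMn -chk_cmb.
apply/edge_invP => x; move/edge_invP: fl => fl; rewrite !(ffunE, ffun_mulrn) fl; congr (_ + _ *+ _).
by rewrite (inj_eq (inv_inj (tauK l))) addrC [tau l x == v]eq_sym [v == _]eq_tau.
Qed.

(* At a vertex v of a plaquette of color l the boundary checks multiply to the
   inverse of the color-l Pauli at v, so a product of color-l plaquette operators is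
   [cmb f l] with f constant around each color-l face. *)
Definition plaq (gam : color -> G) : W :=
  cmb (gam Green) Green + cmb (gam Red) Red + cmb (gam Blue) Blue.

(** The group right after measuring color [c], when [Gam] is the set of colors whose plaquettes are
    already stabilizers. *)
Definition check_plaq (c : color) (Gam : pred color) (z : W) : Prop :=
  exists (bet : G) (gam : color -> G),
    [/\ edge_inv c bet, forall l, face_inv l (gam l), forall l, ~~ Gam l -> gam l = 0 &
        z = cmb bet c + plaq gam].

Lemma plaqE c gam : plaq gam = cmb (gam c) c + cmb (gam (next_color c)) (next_color c)
  + cmb (gam (next_color (next_color c))) (next_color (next_color c)).
Proof.
rewrite /plaq; case: c => //=.
- by rewrite -addrA addrC.
- by rewrite addrC addrA.
Qed.

Lemma sp_plaq gam l v : (forall l, face_inv l (gam l)) -> sp (plaq gam) (chk l v) = 0.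
Proof.
move=> gamP; have gamE l1 : l1 != l -> gam l1 (tau l v) = gam l1 v.
  by have /face_invP := gamP l1; apply.
by rewrite /plaq !spDl !sp_cmb_chk0 ?addr0//; apply: gamE.
Qed.

Lemma face_inv_next l f : edge_inv (next_color l) f -> edge_inv l f ->
  face_inv (next_color (next_color l)) f.
Proof. by move=> f1 f2; apply/andP; rewrite next_color3. Qed.

Lemma check_plaq_step c (Gam : pred color) (z : W) :
  let c' := next_color c in let c2 := next_color c' in
  after_measuring (chks c') (check_plaq c Gam) z <->
  check_plaq c' (fun l => (l == c2) || Gam l) z.
Proof.
move=> c' c2; split.
  move=> [x [e [[bet [gam [bc gamP gam0 ->]]] xe /spanned_chks[bet' b'c' ->] ->]]].
  have bc' : edge_inv c' bet.
    apply/edge_invP => v; have vc : chk c' v \in chks c' by apply/mem_chks; exists v.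
    have := xe _ vc; rewrite spDl sp_plaq// addr0 sp_cmb_chk_next => /eqP.
    by rewrite mulf_eq0 (negPf (cv_neq0 v)) orbF subr_eq0 => /eqP.
  exists (bet' - bet), (fun l => if l == c2 then gam l - bet else gam l); split.
  - apply/edge_invP => v; rewrite !ffunE.
    by move/edge_invP: b'c' => ->; move/edge_invP: bc' => ->.
  - move=> l; case: eqP => [->|//]; apply/face_invP => l' v ll'; rewrite !ffunE.
    have /face_invP -> // := gamP c2.
    by have /face_invP -> := face_inv_next bc' bc.
  - by move=> l; rewrite negb_or => /andP[/negPf ->]; exact: gam0.
  - rewrite !(plaqE c) eqxx.
    have -> : (c == c2) = false by rewrite /c2 /c'; case: (c).
    have -> : (next_color c == c2) = false by rewrite /c2 /c'; case: (c).
    by rewrite !cmbD !cmbN; apply: zmod_shift (cmb_sum bet c).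
move=> [bet' [gam' [b'c' gam'P gam'0 ->]]].
(* If the color-c2 plaquettes are already available, [z] splits directly. Otherwise its c2 part must
   be produced from color-c checks with coefficients [- gam' c2], corrected by color-c' checks. *)
have [G2|G2] := boolP (Gam c2).
  exists (plaq gam'), (cmb bet' c'); split; last by rewrite addrC.
  - exists 0, gam'; split=> //; last by rewrite cmb0 add0r.
      by apply/edge_invP => v; rewrite !ffunE.
    by move=> l Gl; apply: gam'0; rewrite negb_or Gl andbT; apply: contraNneq Gl => ->.
  - by move=> y /mem_chks [v ->]; rewrite sp_plaq.
  - by apply/spanned_chks; exists bet'.
have /andP[] := gam'P c2; rewrite next_color3 -/c' => bc bc'.
pose gam l := if l == c2 then 0 else gam' l.
have gamP l : face_inv l (gam l).
  rewrite /gam; case: eqP => // _; apply/face_invP => l' v _; by rewrite !ffunE.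
exists (cmb (- gam' c2) c + plaq gam), (cmb (bet' - gam' c2) c'); split.
- exists (- gam' c2), gam; split=> //.
    by apply/edge_invP => v; rewrite !ffunE; move/edge_invP: bc => ->.
  move=> l Gl; rewrite /gam; case: eqP => // /eqP lc; apply: gam'0.
  by rewrite negb_or lc.
- move=> y /mem_chks [v ->]; rewrite spDl sp_plaq// addr0 sp_cmb_chk_next !ffunE.
  by move/edge_invP: bc' => ->; rewrite subrr mul0r.
- apply/spanned_chks; exists (bet' - gam' c2) => //; apply/edge_invP => v; rewrite !ffunE.
  by move/edge_invP: b'c' => ->; move/edge_invP: bc' => ->.
- rewrite !(plaqE c) /gam -/c' -/c2 eqxx.
  have -> : (c == c2) = false by rewrite /c2 /c'; case: (c).
  have -> : (c' == c2) = false by rewrite /c2 /c'; case: (c).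
  apply/esym; rewrite cmb0 !cmbD !cmbN addr0.
  have := cmb_sum (gam' c2) c; rewrite -/c' -/c2; move: (cmb (gam' c2) c2) => a2 H.
  have /eqP := H; rewrite addrC addr_eq0 => /eqP ->.
  by rewrite opprD [LHS](AC (1*2*2) (4*((2*3)*(1*5)))).
Qed.

Lemma check_plaq_start (z : W) :
  after_measuring (chks Green) (fun x => x = 0) z <-> check_plaq Green pred0 z.
Proof.
split=> [[x [e [-> _ /spanned_chks[f fi ->] ->]]]|[bet [gam [bi _ gam0 ->]]]].
  exists f, (fun=> 0); split=> //; last by rewrite /plaq !cmb0 !addr0 add0r.
  by move=> l; apply/face_invP => l' v _; rewrite !ffunE.
exists 0, (cmb bet Green); split=> //.
- by move=> y _; rewrite sp0l.
- by apply/spanned_chks; exists bet.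
- by rewrite /plaq !gam0// !cmb0 !addr0 add0r.
Qed.

End Checks.

(** * Relations among generators and the size of the final group *)

Section Relations.
Variables (R : realType) (D : nat).
Hypothesis D_prime : prime D.
Variables (p g : nat) (C : floquet_code R D p g).
Local Notation F := 'F_D.
Local Notation V := (vertex C).
Local Notation G := {ffun V -> F}.
Local Notation W := (G * G)%type.
Implicit Types (v : V) (c l : color) (f : G).

Lemma ev_relation v c (a b d : F) :
  a * (ev v c).1 + b * (ev v (next_color c)).1 + d * (ev v (next_color (next_color c))).1 = 0 ->
  a * (ev v c).2 + b * (ev v (next_color c)).2 + d * (ev v (next_color (next_color c))).2 = 0 ->
  a = b /\ b = d.
Proof.
set c1 := next_color c; set c2 := next_color c1 => h1 h2.
(* Pairing the relation with the Paulis of colors [c] and [c1] leaves (d - b) [cv v] = 0 and (a - d)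
   [cv v] = 0. *)
have pairing l : a * comm (exps v c) (exps v l) + b * comm (exps v c1) (exps v l)
    + d * comm (exps v c2) (exps v l) = 0.
  rewrite !commE -[RHS](subrr 0) -{1}(mul0r (ev v l).1) -{2}(mul0r (ev v l).2) -{1}h2 -h1.
  by ring.
have c02 : comm (exps v c2) (exps v c) = cv v by rewrite -{1}[c]next_color3 comm_next.
have self l : comm (exps v l) (exps v l) = 0 by rewrite commE; ring.
have c01 : comm (exps v c) (exps v c1) = cv v := comm_next D_prime v c.
have c10 : comm (exps v c1) (exps v c) = - cv v by rewrite comm_antisym c01.
have c21 : comm (exps v c2) (exps v c1) = - cv v.
  by rewrite comm_antisym (comm_next D_prime v c1).
have := pairing c; have := pairing c1.
rewrite !self c02 c01 c10 c21 !mulr0 !addr0 add0r !mulrN.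
move=> /eqP; rewrite subr_eq0 => /eqP/(mulIf (cv_neq0 v)) -> /eqP.
by rewrite addrC subr_eq0 => /eqP/(mulIf (cv_neq0 v)) ->.
Qed.

Lemma cmb_relation c (f f1 f2 : G) :
  cmb f c + cmb f1 (next_color c) + cmb f2 (next_color (next_color c)) = 0 -> f = f1 /\ f1 = f2.
Proof.
move=> H.
have E v : f v = f1 v /\ f1 v = f2 v.
  apply: (@ev_relation v c).
    by have /(congr1 (fun x : W => x.1 v)) := H; rewrite /= !ffunE.
  by have /(congr1 (fun x : W => x.2 v)) := H; rewrite /= !ffunE.
by split; apply/ffunP => v; have [] := E v.
Qed.

Lemma face_inv_tau l l' f v : face_inv l f -> l != l' -> f (tau l' v) = f v.
Proof. by move/face_invP; apply. Qed.

Definition all_plaq c : {set W} := [set z | `[< check_plaq c xpredT z >]].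

Lemma edge_invB l f f' : edge_inv l f -> edge_inv l f' -> edge_inv l (f - f').
Proof.
by move=> /edge_invP H /edge_invP H'; apply/edge_invP => v; rewrite !ffunE H H'.
Qed.

Lemma face_invB l f f' : face_inv l f -> face_inv l f' -> face_inv l (f - f').
Proof. by move=> /andP[? ?] /andP[? ?]; apply/andP; split; apply: edge_invB. Qed.

Lemma edge_inv_const l (k : F) : edge_inv l ([ffun=> k] : G).
Proof. by apply/edge_invP => v; rewrite !ffunE. Qed.

(** The additive map [Phi] sends the coefficient tuples [P] onto the group. Its kernel [cst] has D^2
    elements, which gives the factor on the left. *)
Lemma card_all_plaq c : (0 < #|V|)%N ->
  (#|all_plaq c| * D ^ 2 = D ^ (#|V|./2 + #|faces C|))%N.
Proof.
move=> /card_gt0P [v0 _]; pose c1 := next_color c; pose c2 := next_color c1.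
pose B : {set G} := [set f | edge_inv c f]%SET.
pose Fa l : {set G} := [set f | face_inv l f]%SET.
pose P := finset.setX (finset.setX B (Fa c)) (finset.setX (Fa c1) (Fa c2)).
pose T := ((G * G) * (G * G))%type.
pose Phi (q : T) : W := cmb q.1.1 c + cmb q.1.2 c + cmb q.2.1 c1 + cmb q.2.2 c2.
have cardP : #|P| = (D ^ (#|V|./2 + #|faces C|))%N.
  rewrite !cardsX !(card_edge_inv _ (0 : F)) !(card_face_inv _ (0 : F)) card_Fp//.
  rewrite -!expnD -(card_edges C c) mul2n doubleK (card_faces_next C c).
  by rewrite -/c1 -/c2 !addnA.
have BP f : f \in B = edge_inv c f by rewrite inE.
have FP l f : f \in Fa l = face_inv l f by rewrite inE.
have AP z : z \in all_plaq c <-> exists2 q, q \in P & z = Phi q.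
  rewrite inE; split=> [/asboolP[bet [gam [bP gP _ ->]]]|[[[b g0] [g1 g2]]]].
    exists ((bet, gam c), (gam c1, gam c2)); first by rewrite !inE /= bP !gP.
    by rewrite (plaqE c) /Phi /= !addrA.
  rewrite !inE /= => /andP[/andP[bP g0P] /andP[g1P g2P]] ->.
  exists b, (fun l => if l == c then g0 else if l == c1 then g1 else g2).
  split=> //.
    move=> l; case: eqP => [-> //|/eqP lc]; case: eqP => [-> //|/eqP lc1].
    suff -> : l = c2 by [].
    by rewrite eq_sym in lc; have [/eqP|] := next_color_cases lc; rewrite ?(negPf lc1).
  rewrite (plaqE c) -/c1 -/c2 /Phi /= eqxx.
  have -> : (c1 == c) = false by rewrite /c1; case: (c).
  have -> : (c2 == c) = false by rewrite /c2 /c1; case: (c).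
  have -> : (c2 == c1) = false by rewrite /c2 /c1; case: (c).
  by rewrite eqxx !addrA.
have [s sP] : exists s : W -> T, forall z, z \in all_plaq c -> s z \in P /\ z = Phi (s z).
  have H z : exists q, z \in all_plaq c -> q \in P /\ z = Phi q.
    have [/AP[q qP zE]|_] := boolP (z \in all_plaq c); first by exists q.
    by exists 0.
  by have [s sP] := choice H; exists s.
pose cst (k : F * F) : T := (([ffun=> k.1 - k.2], [ffun=> k.2]), ([ffun=> k.1], [ffun=> k.1])).
have PhiD q q' : Phi (q + q') = Phi q + Phi q'.
  rewrite /Phi /= !cmbD; move: (cmb _ _) (cmb _ _) (cmb _ _) (cmb _ _) (cmb _ _) (cmb _ _).
  move=> x1 x2 x3 x4 x5 x6; rewrite [RHS](AC (4*4) (1*5*(2*6)*(3*7)*(4*8))).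
  by [].
have PhiN q : Phi (- q) = - Phi q.
  by apply: (addrI (Phi q)); rewrite -PhiD !subrr /Phi /= !cmb0 !addr0.
have Phi_cst k : Phi (cst k) = 0.
  rewrite /Phi -cmbD; have -> : (cst k).1.1 + (cst k).1.2 = [ffun=> k.1].
    by apply/ffunP => v; rewrite !ffunE subrK.
  exact: cmb_sum.
have cstP k : cst k \in P.
  by rewrite !inE /= /face_inv !edge_inv_const.
have PD q q' : q \in P -> q' \in P -> q - q' \in P.
  rewrite !inE /= => /andP[/andP[? ?] /andP[? ?]] /andP[/andP[? ?] /andP[? ?]].
  by rewrite edge_invB// !face_invB.
(* By [cmb_relation], b + g0 = g1 = g2. Then g1 is invariant along all edges, since g2 covers the
   color missing for g1; as b is invariant along color-c edges, so is g0. Connectedness makes g0 and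
   g1 constant, and b is their difference. *)
have ker q : q \in P -> Phi q = 0 -> exists k, q = cst k.
  case: q => [[b g0] [g1 g2]]; rewrite !inE /= => /andP[/andP[bP g0P] /andP[g1P g2P]].
  rewrite /Phi /= -cmbD => /cmb_relation [E1 E2].
  have g1E l v : g1 (tau l v) = g1 v.
    have [<-|lc] := eqVneq c1 l; last exact: face_inv_tau lc.
    by rewrite E2; apply: (face_inv_tau _ g2P); rewrite /c2; case: (c1).
  have g0E l v : g0 (tau l v) = g0 v.
    have [<-|lc] := eqVneq c l; last exact: face_inv_tau lc.
    apply: (addrI (b v)); have := congr1 (fun f : G => f v) E1.
    have := congr1 (fun f : G => f (tau c v)) E1; rewrite !ffunE.
    by move/edge_invP: bP => ->; rewrite g1E => -> ->.
  exists (g1 v0, g0 v0); rewrite /cst -E2 /=; congr ((_, _), (_, _)); apply/ffunP => v; rewrite !ffunE.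
  - have := congr1 (fun f : G => f v) E1; rewrite ffunE.
    by rewrite (tau_connected g1E v v0) (tau_connected g0E v v0) => <-; rewrite addrK.
  - exact: (tau_connected g0E).
  - exact: (tau_connected g1E).
  - exact: (tau_connected g1E).
rewrite -cardP.
(* The section [s] of [Phi] plus a kernel element: a bijection from the group times F_D^2 onto
   [P]. *)
pose h (x : W * (F * F)) : T := s x.1 + cst x.2.
have -> : P = [set h x | x in finset.setX (all_plaq c) [set: F * F]]%SET.
  apply/setP => q; apply/idP/imsetP => [qP|[[z k]]].
    have zA : Phi q \in all_plaq c by apply/AP; exists q.
    have [sP1 zE] := sP _ zA.
    have [||k qE] := ker (q - s (Phi q)); first exact: PD.
      by rewrite PhiD PhiN -zE subrr.
    exists (Phi q, k); first by rewrite finset.in_setX zA finset.in_setT.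
    by rewrite /h /= -qE addrC subrK.
  rewrite finset.in_setX finset.in_setT andbT => zA ->; rewrite /h /=.
  have [sP1 _] := sP z zA.
  have cNP : - cst k \in P by rewrite -[- _]sub0r; apply: (PD) => //; rewrite -(subrr (cst k)); exact: PD.
  by rewrite -[cst k]opprK; exact: PD.
rewrite card_in_imset => [|[z k] [z' k']]; first by rewrite cardsX cardsT card_prod card_Fp.
rewrite !finset.in_setX !finset.in_setT !andbT => zA z'A hh.
have zz' : z = z'.
  have [_ ->] := sP _ zA; have [_ ->] := sP _ z'A.
  by have := congr1 Phi hh; rewrite /h /= !PhiD !Phi_cst !addr0.
move: hh; rewrite /h /= zz' => /addrI [_ /ffunP/(_ v0) + /ffunP/(_ v0)].
by case: k k' => [k0 k1] [k0' k1']; rewrite !ffunE /= => -> ->.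
Qed.

End Relations.

(** * Runs of the Floquet code and the number of logical qudits *)

Section Runs.
Variables (R : realType) (D : nat).
Hypothesis D_prime : prime D.
Variables (p g : nat) (C : floquet_code R D p g).
Local Notation F := 'F_D.
Local Notation V := (vertex C).
Local Notation G := {ffun V -> F}.
Local Notation W := (G * G)%type.
Local Notation op := 'M[R[i]]_(hdim V D).
Local Notation wop := (@wop R D V).

Lemma wop_injective : injective wop.
Proof.
by move=> x y xy; apply: (wop_inj D_prime (oner_neq0 R[i]) (b := 1)); rewrite !scale1r.
Qed.

Lemma spanned_sub (ys ys' : seq W) e : {subset ys <= ys'} -> spanned ys e -> spanned ys' e.
Proof.
elim: ys e => [|y ys IH] e /= yy'; first by move=> ->; exact: spanned0.
move=> [k [e' [se ->]]]; apply: spannedD.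
  by apply: IH se => z zy; apply: yy'; rewrite inE zy orbT.
by apply: spanned_mem; apply: yy'; rewrite mem_head.
Qed.

(** The operators come in an arbitrary order. Injectivity of [wop] recovers a list of labels with
    the same members as [chks C l], and [after_measuring] depends on the members only. *)
Lemma stab_round l S S' (L : W -> Prop) : stab S L -> measured_all (checks C l) S S' ->
  stab S' (after_measuring (chks C l) L).
Proof.
move=> SL [s [_ sP ms]].
have [ys sE yl] : exists2 ys, s = map wop ys & {subset ys <= chks C l}.
  have : {subset s <= [seq wop y | y <- chks C l]}.
    move=> P /sP/(checksP D_prime)[v ->]; apply: map_f; apply/mem_chks; by exists v.
  elim: s {sP ms} => [|P s IH] ss; first by exists [::].
  have [P' P's|ys -> yl] := IH; first by apply: ss; rewrite inE P's orbT.
  have /mapP [y yc ->] : P \in [seq wop y | y <- chks C l] by apply: ss; rewrite mem_head.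
  by exists (y :: ys) => // z; rewrite inE => /orP[/eqP ->|/yl].
have ly : {subset chks C l <= ys}.
  move=> y /mem_chks [v ->].
  have : wop (chk l v) \in s by apply/sP/(checksP D_prime); exists v.
  by rewrite sE => /mapP [y' y'ys /wop_injective ->].
rewrite sE in ms.
have := stab_measured D_prime (commuting_chks D_prime yl) SL ms.
apply: stab_ext => z; split=> -[x [e [Lx xP se ->]]]; exists x, e; split=> //.
- by move=> y /ly; exact: xP.
- exact: spanned_sub se.
- by move=> y /yl; exact: xP.
- exact: spanned_sub se.
Qed.

Lemma round_ex l S (L : W -> Prop) : stab S L ->
  exists S' : set op, measured_all (checks C l) S S'.
Proof.
move=> SL.
have [S' mS] := measured_ex D_prime (commuting_chks D_prime (fun y => id) : commuting_checks R (chks C l)) SL.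
exists S', (map wop (chks C l)); split=> //.
  by rewrite map_inj_uniq ?undup_uniq//; exact: wop_injective.
move=> P; split=> [/mapP [y /mem_chks [v ->] ->]|/(checksP D_prime)[v ->]].
  by apply/(checksP D_prime); exists v.
by apply: map_f; apply/mem_chks; exists v.
Qed.

(** Round 0 reveals no plaquette. Each later round adds those of the color different from the last
    two measured, so all three colors are known from round 3 on. *)
Fixpoint known_plaq t : pred color :=
  if t is t'.+1 then fun l => (l == next_color (next_color (schedule t'))) || known_plaq t' l
  else pred0.

Lemma scheduleS t : schedule t.+1 = next_color (schedule t).
Proof.
rewrite /schedule -addn1 -modnDml; have : (t %% 3 < 3)%N by rewrite ltn_mod.
by case: (t %% 3)%N => [|[|[|]]].
Qed.

Lemma known_plaq_all t l : (3 <= t)%N -> known_plaq t l.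
Proof.
move=> /subnK <-; rewrite addnC.
by elim: (t - 3)%N => [|k IH]; [case: l | rewrite addnS; apply/orP; right; exact: IH].
Qed.

Lemma run_stab S : is_run C S ->
  forall t, stab (S t.+1) (@check_plaq R D p g C (schedule t) (known_plaq t)).
Proof.
move=> [S0 SS]; elim=> [|t IH].
  have := SS 0%N; rewrite S0 => /(stab_round (stab_start R V D_prime)).
  by apply: stab_ext => z; exact: check_plaq_start.
have := stab_round IH (SS t.+1); apply: stab_ext => z.
by rewrite scheduleS; exact: check_plaq_step.
Qed.

(** Without a run, [encodes] would hold vacuously for every k. Each round can be carried out because
    possible outcomes exist. *)
Lemma run_ex : exists S, is_run C S.
Proof.
pose inv (S : set op) := exists L : W -> Prop, stab S L.
have step (x : nat * set op) : exists S', inv x.2 -> measured_all (checks C (schedule x.1)) x.2 S'.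
  have [[L SL]|ni] := pselect (inv x.2); last by exists x.2.
  by have [S' ?] := round_ex (schedule x.1) SL; exists S'.
have [nxt nxtP] := choice step.
pose S := fix S t : set op := if t is t'.+1 then nxt (t', S t') else [set A | A = 1].
have Sinv t : inv (S t).
  elim: t => [|t IH]; first by exists (fun x => x = 0); exact: (stab_start R V D_prime).
  have [L SL] := IH; exists (after_measuring (chks C (schedule t)) L).
  by apply: stab_round SL _; exact: (nxtP (t, S t) IH).
by exists S; split=> // t; exact: (nxtP (t, S t) (Sinv t)).
Qed.

Definition logical_qudits : nat := (#|V|./2 + 2 - #|faces C|)%N.

Hypotheses (p6 : (6 <= p)%N) (g2 : (2 <= g)%N).

Lemma V_gt0 : (0 < #|V|)%N.
Proof. by apply: (@vertices_gt0 p g C); rewrite gtn_eqF. Qed.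

Lemma halfV : (2 * #|V|./2 = #|V|)%N.
Proof. by rewrite -(card_edges C Green) !mul2n doubleK. Qed.

(** From p #faces = 3n and p at least 6 there are at most n/2 faces, so the truncated subtraction is
    exact. *)
Lemma logical_quditsE : (logical_qudits + #|faces C| = #|V|./2 + 2)%N.
Proof.
rewrite /logical_qudits subnK//.
have := card_faces_size C; have := halfV; nia.
Qed.

Lemma run_has_dim S t : is_run C S -> (3 <= t)%N ->
  has_dim (codespace (S t.+1)) (D ^ logical_qudits)%N.
Proof.
move=> runS t3; apply: (stab_dim D_prime (A := all_plaq C (schedule t))).
  apply: stab_ext (run_stab runS t) => z; rewrite inE asboolE.
  split=> -[bet [gam [? ? H ->]]]; exists bet, gam; split=> // l.
  by rewrite known_plaq_all.
apply/eqP; rewrite -(eqn_pmul2r (m := (D ^ 2)%N)) ?expn_gt0 ?prime_gt0//.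
rewrite -mulnA (card_all_plaq D_prime _ V_gt0) -!expnD; apply/eqP; congr (_ ^ _)%N.
by rewrite addnCA logical_quditsE addnA addnn -mul2n halfV.
Qed.

Lemma encodes_logical : encodes C logical_qudits.
Proof. by exists 3%N => S runS t t3; exact: run_has_dim. Qed.

Lemma encodes_uniq k : encodes C k -> k = logical_qudits.
Proof.
move=> [T HT]; have [S runS] := run_ex.
(* One round beyond both thresholds gives the same code space two dimensions, D^k and the computed
   one. *)
have h1 := HT _ runS _ (leq_maxl T 3); have h2 := run_has_dim runS (leq_maxr T 3).
by have /eqP := has_dim_inj h1 h2; rewrite eqn_exp2l ?prime_gt1// => /eqP.
Qed.

Lemma rateE : logical_qudits%:R / (qudits C)%:R = 1 / 2 - 3 / p%:R + 2 / (qudits C)%:R :> R.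
Proof.
have n0 : (qudits C)%:R != 0 :> R by rewrite pnatr_eq0 -lt0n V_gt0.
have p0 : p%:R != 0 :> R by rewrite pnatr_eq0; lia.
have h1 : logical_qudits%:R + #|faces C|%:R = (#|V|./2)%:R + 2 :> R.
  by rewrite -!natrD logical_quditsE.
have h2 : 2 * (#|V|./2)%:R = (qudits C)%:R :> R by rewrite -natrM halfV.
have h3 : p%:R * #|faces C|%:R = 3 * (qudits C)%:R :> R by rewrite -!natrM card_faces_size.
have -> : logical_qudits%:R = (qudits C)%:R / 2 + 2 - 3 * (qudits C)%:R / p%:R :> R.
  by rewrite -h3 -h2 mulrAC mulfV// mul1r mulrAC mulfV// mul1r -h1 addrK.
by field; rewrite n0 p0.
Qed.

End Runs.

(** * The limit of the encoding rate *)

Lemma cvg_nat_inv (R : realType) (f : nat -> nat) :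
  f @ \oo --> \oo -> (fun i => (f i)%:R^-1 : R) @ \oo --> 0.
Proof.
move=> fy; apply/(@gtr0_cvgV0 R _ _ _ (fun i => (f i)%:R)).
  have : \forall i \near \oo, (1 <= f i)%N by exact: (fy _ (nbhs_infty_ge 1)).
  by apply: filterS => i; rewrite ltr0n.
exact/cvgrnyP.
Qed.

Theorem proposition3 (R : realType) (D : nat) (D_prime : prime D) :
  (forall (p g : nat) (F : floquet_code R D p g),
     (6 <= p)%N -> (2 <= g)%N ->
     exists k : nat,
       [/\ encodes F k, (forall k' : nat, encodes F k' -> k' = k) &
           k%:R / (qudits F)%:R
             = 1 / 2 - 3 / p%:R + 2 / (qudits F)%:R :> R])
  /\
  (forall (p g k : nat -> nat) (F : forall i : nat, floquet_code R D (p i) (g i)),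
     (forall i, (6 <= p i)%N) -> (forall i, (2 <= g i)%N) ->
     (forall i, encodes (F i) (k i)) ->
     (fun i : nat => qudits (F i)) @ \oo --> \oo ->
     p @ \oo --> \oo ->
     (fun i : nat => (k i)%:R / (qudits (F i))%:R : R) @ \oo --> (1 / 2 : R)).
Proof.
split=> [p g F p6 g2|p g k F p6 g2 kF ny py].
  exists (logical_qudits F); split; [exact: encodes_logical | | exact: rateE].
  by move=> k; exact: encodes_uniq.
(* Each [k i] is given only through [encodes]; uniqueness replaces it by the closed formula before
   passing to the limit. *)
have -> : (fun i => (k i)%:R / (qudits (F i))%:R : R) =
    (fun i => 1 / 2 - 3 * (p i)%:R^-1 + 2 * (qudits (F i))%:R^-1).
  by apply/funext => i; rewrite (encodes_uniq D_prime (p6 i) (g2 i) (kF i)) rateE.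
rewrite -[X in _ --> X]addr0 -[X in _ --> X + _]subr0.
apply: cvgD; [apply: cvgB; first exact: cvg_cst|].
  by rewrite -[X in _ --> X](mulr0 3); apply: cvgM; [exact: cvg_cst | exact: cvg_nat_inv].
by rewrite -[X in _ --> X](mulr0 2); apply: cvgM; [exact: cvg_cst | exact: cvg_nat_inv].
Qed.
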